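(* Let $X$ be a locally compact metric space, let $F:X\to\mathcal P(X)$ be (the generator of) a discrete multivalued dynamical system on $X$ that is determined by a morphism, and let $S$ be an isolated invariant set for $F$. Then the cohomological Conley index $C(S,F)=L(H^*(P),I_P)$ is independent (up to isomorphism of graded modules equipped with endomorphisms) of the choice of an isolating neighbourhood $N$ for $S$ and of a weak index pair $P$ in $N$. That is, if $M,N$ are isolating neighbourhoods for $S$ (so $\operatorname{Inv}M=\operatorname{Inv}N=S$), $P$ is a weak index pair in $N$ and $Q$ is a weak index pair in $M$, then $L(H^*(P),I_P)\cong L(H^*(Q),I_Q)$.
   Context: $\mathcal P(X)$ is the set of all subsets of $X$; $\operatorname{int}$, $\operatorname{cl}$ denote interior and closure in $X$. A map $G:Y\to\mathcal P(X)$ is upper semicontinuous (usc) if $\{y\in Y\mid G(y)\cap B\neq\varnothing\}$ is closed for every closed $B\subset X$; $G(A)=\bigcup_{y\in A}G(y)$. A discrete multivalued dynamical system (dmds) is a usc map $F:X\times\mathbb Z\to\mathcal P(X)$ with compact values such that (i) $F(x,0)=\{x\}$; (ii) $F(F(x,n),m)=F(x,n+m)$ for all $x$ and all $n,m\in\mathbb Z$ with $nm\ge 0$; (iii) $y\in F(x,-1)\Leftrightarrow x\in F(y,1)$. The dmds is identified with its generator $F(x):=F(x,1)$. For $N\subset X$, $\operatorname{Inv}N$ is the set of $x\in N$ for which there is $\sigma:\mathbb Z\to N$ with $\sigma(0)=x$ and $\sigma(n+1)\in F(\sigma(n))$ for all $n\in\mathbb Z$. A compact set $N$ is an isolating neighbourhood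 for $F$ if $\operatorname{Inv}N\subset\operatorname{int}N$; a compact set $S$ with $S=\operatorname{Inv}S$ is an isolated invariant set if $S=\operatorname{Inv}N$ for some isolating neighbourhood $N$, and then $N$ is called an isolating neighbourhood for $S$. Let $\operatorname{bd}_F(A):=\operatorname{cl}A\cap\operatorname{cl}(F(A)\setminus A)$. A weak index pair in $N$ is a pair $P=(P_1,P_2)$ of compact sets $P_2\subset P_1\subset N$ such that (a) $F(P_i)\cap N\subset P_i$, $i=1,2$; (b) $\operatorname{bd}_F(P_1)\subset P_2$; (c) $\operatorname{Inv}N\subset\operatorname{int}(P_1\setminus P_2)$; (d) $P_1\setminus P_2\subset\operatorname{int}N$. $H^*$ is Alexander–Spanier cohomology with integer coefficients. ''$F$ is determined by a morphism'' (in the sense of Górniewicz) means: there are a Hausdorff space $\Gamma$, a Vietoris map $p:\Gamma\to X$ (continuous, proper, surjective, with all fibres acyclic for $H^*$) and a continuous $q:\Gamma\to X$ with $F(x)=q(p^{-1}(x))$ for all $x\in X$; such $(p,q)$ is fixed. If $F$ maps a compact pair $P$ into a pair $T$ (i.e. $F(P_i)\subset T_i$), the induced homomorphism $H^*(F_{P,T}):H^*(T)\to H^*(P)$ is $(p_P^* )^{-1}\circ q_P^*$, where $p_P:(p^{-1}(P_1),p^{-1}(P_2))\to P$ and $q_P:(p^{-1}(P_1),p^{-1}(P_2))\to T$ are the restrictions of $p,q$. For a weak index pair $P$ in $N$ put $T(P)=T_N(P):=(P_1\cup(X\setminus\operatorname{int}N),\,P_2\cup(X\setminus\operatorname{int}N))$.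 Then $F(P_i)\subset T_i(P)$ and the inclusion $i_P:P\to T(P)$ induces an isomorphism in $H^*$. The index map is $I_P:=H^*(F_{P,T(P)})\circ H^*(i_P)^{-1}:H^*(P)\to H^*(P)$. The Leray functor $L$: for a graded module $H$ with a degree-zero endomorphism $\varphi$, let $H':=H/\bigcup_{n\ge1}\ker\varphi^n$ with the induced injective endomorphism $\varphi'$; then $L(H,\varphi)$ is the graded module $\bigcap_{n\ge1}\varphi'^n(H')$ together with the automorphism given by the restriction of $\varphi'$. *)

(* Defs.v *)
From HB Require Import structures.
From mathcomp Require Import all_boot all_order all_algebra.
From mathcomp Require Import all_classical all_reals all_analysis.

Set Implicit Arguments.
Unset Strict Implicit.
Unset Printing Implicit Defensive.

Import Order.TTheory GRing.Theory Num.Theory.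
Import Quotient.

Local Open Scope classical_set_scope.
Local Open Scope ring_scope.
Local Open Scope quotient_scope.

Definition set_pred (T : Type) (A : set T) : {pred T} := fun x => `[< A x >].

Lemma set_predP (T : Type) (A : set T) (x : T) :
  reflect (A x) (x \in set_pred A).
Proof. exact: asboolP. Qed.

Record subgrp (V : zmodType) (S : zmodClosed V) :=
  Subgrp { subgrp_val : V; _ : subgrp_val \in S }.

Section SubgrpInstances.
Variables (V : zmodType) (S : zmodClosed V).
HB.instance Definition _ := [isSub for @subgrp_val V S].
HB.instance Definition _ := [Choice of subgrp S by <:].
HB.instance Definition _ := [SubChoice_isSubZmodule of subgrp S by <:].
End SubgrpInstances.

Section SubgrpMap.
Variables (V W : zmodType) (S : zmodClosed V) (S' : zmodClosed W).
Variables (f : {additive V -> W}) (fS : forall x, x \in S -> f x \in S').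

Definition subgrp_map (x : subgrp S) : subgrp S' := Subgrp (fS (valP x)).

Lemma subgrp_map_is_zmod_morphism : zmod_morphism subgrp_map.
Proof. by move=> x y; apply: val_inj; rewrite !raddfB /= raddfB. Qed.

HB.instance Definition _ := GRing.isZmodMorphism.Build (subgrp S) (subgrp S')
  subgrp_map subgrp_map_is_zmod_morphism.
End SubgrpMap.
Arguments subgrp_map {V W S S' f} fS.

Section QuotMap.
Variables (V W : zmodType) (I : zmodClosed V) (J : zmodClosed W).
Variable f : {additive V -> W}.

(* The unused hypothesis is what makes quot_map additive. *)
Definition quot_map (fI : forall x, x \in I -> f x \in J) (x : {quot I}) :
  {quot J} := \pi_({quot J}) (f (repr x)).

Variable fI : forall x, x \in I -> f x \in J.

Lemma quot_map_pi x : quot_map fI (\pi_({quot I}) x) = \pi_({quot J}) (f x).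
Proof.
apply/eqP; rewrite -idealrBE -raddfB; apply: fI.
by rewrite idealrBE reprK.
Qed.

Lemma quot_map_is_zmod_morphism : zmod_morphism (quot_map fI).
Proof.
move=> x y; rewrite -[x]reprK -[y]reprK -raddfB !quot_map_pi.
by rewrite !raddfB.
Qed.

HB.instance Definition _ := GRing.isZmodMorphism.Build {quot I} {quot J}
  (quot_map fI) quot_map_is_zmod_morphism.
End QuotMap.
Arguments quot_map {V W I J f} fI.

(* Inverse of an additive map.  The value 0 for a map that is not bijective is
   a convention which makes the inverse total and always additive. *)
Section AdditiveInverse.
Variables (V W : zmodType) (f : {additive V -> W}).

Definition additive_inv (y : W) : V :=
  if `[< bijective f >] then xget 0 [set x | f x = y] else 0.

Lemma additive_invK : bijective f -> cancel additive_inv f.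
Proof.
move=> bf y; rewrite /additive_inv (asboolT bf).
case: bf => g _ gK.
by case: xgetP => [x _ //|/(_ (g y))]; rewrite /= gK.
Qed.

Lemma additive_inv_is_zmod_morphism : zmod_morphism additive_inv.
Proof.
move=> x y; have [bf|nbf] := pselect (bijective f); last first.
  by rewrite /additive_inv !(asboolF nbf) subrr.
by apply: (bij_inj bf); rewrite raddfB !additive_invK.
Qed.

HB.instance Definition _ := GRing.isZmodMorphism.Build W V
  additive_inv additive_inv_is_zmod_morphism.
End AdditiveInverse.

Definition zmod_comp (U V W : zmodType) (g : {additive V -> W})
  (f : {additive U -> V}) : {additive U -> W} := g \o f.

(* Nonnegatively graded Z-modules with a degree-zero endomorphism. *)
Record gmod_endo := GmodEndo {
  gmod : nat -> zmodType;
  gendo : forall q, {additive gmod q -> gmod q} }.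
Arguments gendo {g q}.

Definition gmod_iso (A B : gmod_endo) : Prop :=
  exists f : forall q, {additive gmod A q -> gmod B q},
    forall q, bijective (f q) /\
      forall x, f q (gendo x) = gendo (f q x).

Lemma iter_additiveB (V : zmodType) (f : {additive V -> V}) n x y :
  iter n f (x - y) = iter n f x - iter n f y.
Proof. by elim: n => //= n ->; rewrite raddfB. Qed.

Lemma iter_additive0 (V : zmodType) (f : {additive V -> V}) n :
  iter n f 0 = 0.
Proof. by elim: n => //= n ->; rewrite raddf0. Qed.

Section Leray.
Variables (H : zmodType) (phi : {additive H -> H}).

Definition gker : {pred H} :=
  set_pred [set x | exists2 n, (0 < n)%N & iter n phi x = 0].

Lemma gker_zmod_closed : zmod_closed gker.
Proof.
split=> [|x y]; first by apply/set_predP; exists 1%N => //=; rewrite raddf0.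
move=> /set_predP[n n0 xn] /set_predP[m m0 ym]; apply/set_predP.
exists (n + m)%N; first by rewrite addn_gt0 n0.
by rewrite iter_additiveB {1}addnC !iterD xn ym !iter_additive0 subrr.
Qed.

HB.instance Definition _ := GRing.isZmodClosed.Build H gker gker_zmod_closed.

Lemma gker_stable x : x \in gker -> phi x \in gker.
Proof.
move=> /set_predP[n n0 xn]; apply/set_predP; exists n => //.
by rewrite -iterSr iterS xn raddf0.
Qed.

Definition leray_quot : zmodType := {quot gker}.
Definition leray_quot_map : {additive leray_quot -> leray_quot} :=
  quot_map gker_stable.

Definition grange : {pred leray_quot} :=
  set_pred [set x | forall n, (0 < n)%N ->
                      exists y, iter n leray_quot_map y = x].

Lemma grange_zmod_closed : zmod_closed grange.
Proof.
split=> [|x y].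
  by apply/set_predP => n _; exists 0; rewrite iter_additive0.
move=> /set_predP hx /set_predP hy; apply/set_predP => n n0.
have [x' <-] := hx n n0; have [y' <-] := hy n n0.
by exists (x' - y'); rewrite iter_additiveB.
Qed.

HB.instance Definition _ :=
  GRing.isZmodClosed.Build leray_quot grange grange_zmod_closed.

Lemma grange_stable x : x \in grange -> leray_quot_map x \in grange.
Proof.
move=> /set_predP hx; apply/set_predP => n n0; have [y <-] := hx n n0.
by exists (leray_quot_map y); rewrite -iterSr iterS.
Qed.

Definition leray_mod : zmodType := subgrp grange.
Definition leray_endo : {additive leray_mod -> leray_mod} :=
  subgrp_map grange_stable.

Lemma leray_quot_map_inj : injective leray_quot_map.
Proof.
suff ker0 x : leray_quot_map x = 0 -> x = 0.
  move=> x y xy; apply/subr0_eq/ker0; rewrite raddfB.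
  by apply/eqP; rewrite subr_eq0; apply/eqP; exact: xy.
have pi0 z : (z \in gker) = (\pi_({quot gker}) z == 0).
  by rewrite -{1}[z]subr0 idealrBE raddf0.
rewrite -[x]reprK [leray_quot_map _]quot_map_pi => /eqP.
rewrite -pi0 => /set_predP[n n0 xn].
apply/eqP; rewrite -pi0; apply/set_predP; exists n.+1 => //.
by rewrite iterSr.
Qed.

Lemma leray_endo_bij : bijective leray_endo.
Proof.
have inj : injective leray_endo.
  by move=> x y /(congr1 val) /leray_quot_map_inj /val_inj.
have surj y : exists x, leray_endo x = y.
  have /set_predP hy := valP y.
  have [x /= xy] := hy 1%N isT.
  suff xr : x \in grange by exists (Subgrp xr); apply: val_inj.
  apply/set_predP => n n0; have [z zy] := hy n.+1 isT.
  by exists z; apply: leray_quot_map_inj; exact: etrans zy (esym xy).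
have [g gK] := choice surj.
by exists g => // x; apply: inj; rewrite gK.
Qed.
End Leray.

Definition leray (A : gmod_endo) : gmod_endo :=
  @GmodEndo (fun q => leray_mod (@gendo A q)) (fun q => leray_endo (@gendo A q)).

Definition cochain (X : Type) (q : nat) : Type := ('I_q.+1 -> X) -> int.
HB.instance Definition _ X q := GRing.Zmodule.on (cochain X q).

Definition coboundary (X : Type) (q : nat) (phi : cochain X q) :
    cochain X q.+1 :=
  fun t => \sum_(i < q.+2) (-1) ^+ i * phi (fun j => t (lift i j)).

Lemma coboundaryB X q (phi psi : cochain X q) :
  coboundary (phi - psi) = coboundary phi - coboundary psi.
Proof.
apply/funext => t; rewrite /coboundary.
transitivity (\sum_(i < q.+2) ((-1) ^+ i * phi (fun j => t (lift i j))
                             - (-1) ^+ i * psi (fun j => t (lift i j)))).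
  by apply: eq_bigr => i _; rewrite -mulrBr.
by rewrite sumrB.
Qed.

Lemma coboundary0 X q : coboundary (0 : cochain X q) = 0.
Proof. by rewrite -[X in coboundary X](subrr 0) coboundaryB subrr. Qed.

(* The restriction of phi to A^(q+1) is locally zero on the subspace A. *)
Definition locally_zero (X : topologicalType) (A : set X) (q : nat)
    (phi : cochain X q) : Prop :=
  forall x, A x -> exists2 U, nbhs x U &
    forall t : 'I_q.+1 -> X, (forall i, (U `&` A) (t i)) -> phi t = 0.

Lemma locally_zero0 (X : topologicalType) (A : set X) q :
  locally_zero A (0 : cochain X q).
Proof. by move=> x _; exists setT => //; exact: filterT. Qed.

Lemma locally_zeroB (X : topologicalType) (A : set X) q (f g : cochain X q) :
  locally_zero A f -> locally_zero A g -> locally_zero A (f - g).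
Proof.
move=> hf hg x Ax; have [U xU fU] := hf x Ax; have [V xV gV] := hg x Ax.
exists (U `&` V); first exact: filterI.
move=> t ht; rewrite -[LHS]/(f t - g t) fU ?gV ?subrr // => i;
  by have [[]] := ht i.
Qed.

Definition cochain_pullback (X Y : Type) (f : X -> Y) (q : nat)
  (phi : cochain Y q) : cochain X q := fun t => phi (f \o t).

Lemma cochain_pullback_is_zmod_morphism X Y (f : X -> Y) q :
  zmod_morphism (@cochain_pullback X Y f q).
Proof. by []. Qed.

HB.instance Definition _ X Y (f : X -> Y) q :=
  GRing.isZmodMorphism.Build (cochain Y q) (cochain X q)
    (@cochain_pullback X Y f q) (cochain_pullback_is_zmod_morphism f (q := q)).

Lemma coboundary_pullback X Y (f : X -> Y) q (phi : cochain Y q) :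
  coboundary (cochain_pullback f phi) = cochain_pullback f (coboundary phi).
Proof. by []. Qed.

Lemma locally_zero_pullback (X Y : topologicalType) (A : set X) (B : set Y) q
    (f : X -> Y) (phi : cochain Y q) : continuous f ->
  (forall x, A x -> B (f x)) -> locally_zero B phi ->
  locally_zero A (cochain_pullback f phi).
Proof.
move=> cf fAB hphi x Ax; have [U xU phiU] := hphi (f x) (fAB x Ax).
exists (f @^-1` U); first exact: cf.
by move=> t ht; apply: phiU => i; have [Ui Ai] := ht i; split=> //; exact: fAB.
Qed.

Record toppair := TopPair {
  tp_space :> topologicalType;
  tp_sub : set tp_space }.

Record pair_map (P Q : toppair) := PairMap {
  pm_fun :> P -> Q;
  pm_continuous : continuous pm_fun;
  pm_sub : forall x, tp_sub x -> tp_sub (pm_fun x) }.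

(* Alexander-Spanier cohomology with integer coefficients.  Let C^q(X,A) be the
   group of all functions X^(q+1) -> int whose restriction to A is locally zero,
   and C_0^q(X) the subgroup of locally zero functions; as_cohom (X,A) q is the
   q-th cohomology group of the quotient complex C^*(X,A) / C_0^*(X), with its
   cocycles and coboundaries written in terms of representatives in C^q(X,A). *)
Section AlexanderSpanier.
Variables (P : toppair) (q : nat).

Definition as_cocycle : {pred cochain P q} :=
  set_pred [set phi : cochain P q | locally_zero (@tp_sub P) phi /\
                                    locally_zero [set: P] (coboundary phi)].

Lemma as_cocycle_zmod_closed : zmod_closed as_cocycle.
Proof.
split=> [|f g].
  by apply/set_predP; split; rewrite ?coboundary0; exact: locally_zero0.
move=> /set_predP[f1 f2] /set_predP[g1 g2]; apply/set_predP.
by split; rewrite ?coboundaryB; exact: locally_zeroB.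
Qed.

HB.instance Definition _ :=
  GRing.isZmodClosed.Build (cochain P q) as_cocycle as_cocycle_zmod_closed.

Definition cobounds (phi : cochain P q) : Prop :=
  match q return cochain P q -> Prop with
  | 0%N => fun phi => locally_zero [set: P] phi
  | r.+1 => fun phi => exists2 psi : cochain P r,
      locally_zero (@tp_sub P) psi &
      locally_zero [set: P] (phi - coboundary psi)
  end phi.

Definition as_coboundary : {pred subgrp as_cocycle} :=
  set_pred [set z | cobounds (val z)].

Lemma cobounds0 : cobounds 0.
Proof.
rewrite /cobounds; case: q => [|r]; first exact: locally_zero0.
exists 0; first exact: locally_zero0.
by rewrite coboundary0 subr0; exact: locally_zero0.
Qed.

Lemma coboundsB f g : cobounds f -> cobounds g -> cobounds (f - g).
Proof.
rewrite /cobounds; move: f g; case: q => [|r] f g; first exact: locally_zeroB.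
move=> [f' f'A f'0] [g' g'A g'0]; exists (f' - g'); first exact: locally_zeroB.
suff -> : f - g - coboundary (f' - g') =
    (f - coboundary f') - (g - coboundary g') by exact: locally_zeroB.
by rewrite coboundaryB !opprB addrACA [RHS]addrACA (addrC (- g)).
Qed.

Lemma as_coboundary_zmod_closed : zmod_closed as_coboundary.
Proof.
split=> [|f g]; first by apply/set_predP; exact: cobounds0.
by move=> /set_predP hf /set_predP hg; apply/set_predP; exact: coboundsB.
Qed.

HB.instance Definition _ := GRing.isZmodClosed.Build
  (subgrp as_cocycle) as_coboundary as_coboundary_zmod_closed.

Definition as_cohom : zmodType := {quot as_coboundary}.
End AlexanderSpanier.
Arguments as_cocycle : clear implicits.
Arguments as_coboundary : clear implicits.

Section InducedMap.
Variables (P Q : toppair) (f : pair_map P Q) (q : nat).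

Lemma pullback_cocycle (phi : cochain Q q) :
  phi \in as_cocycle Q q -> cochain_pullback f phi \in as_cocycle P q.
Proof.
move=> /set_predP[h1 h2]; apply/set_predP; split.
  by apply: locally_zero_pullback h1; [exact: pm_continuous|exact: pm_sub].
by apply: locally_zero_pullback h2 => //; exact: pm_continuous.
Qed.

Definition cocycle_pullback :
    {additive subgrp (as_cocycle Q q) -> subgrp (as_cocycle P q)} :=
  subgrp_map pullback_cocycle.

Lemma pullback_coboundary z :
  z \in as_coboundary Q q -> cocycle_pullback z \in as_coboundary P q.
Proof.
move=> /set_predP hz; apply/set_predP; move: hz; rewrite /= /cobounds.
have cf := @pm_continuous _ _ f.
move: (val z) => {z}; case: q => [|r] phi /=.
  by move=> h; exact: locally_zero_pullback h.
move=> [psi h1 h2]; exists (cochain_pullback f psi).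
  by apply: locally_zero_pullback h1 => //; exact: pm_sub.
by rewrite coboundary_pullback -raddfB; exact: locally_zero_pullback h2.
Qed.

Definition as_cohom_map : {additive as_cohom Q q -> as_cohom P q} :=
  quot_map pullback_coboundary.
End InducedMap.

Definition subset_pair (Y : topologicalType) (P : set Y * set Y) : toppair :=
  @TopPair (set_type P.1) [set x | P.2 (val x)].

Section SubsetPairs.
Variables (Y Z : topologicalType).
Variables (P : set Y * set Y) (Q : set Z * set Z) (f : Y -> Z).
Hypotheses (cf : continuous f) (f1 : P.1 `<=` f @^-1` Q.1)
  (f2 : P.2 `<=` f @^-1` Q.2).

Definition restrict (x : subset_pair P) : subset_pair Q :=
  exist _ (f (val x)) (mem_set (f1 (set_mem (valP x)))).

Lemma restrict_continuous : continuous restrict.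
Proof.
apply: (@continuous_comp_initial _ _ _ (set_val : set_type Q.1 -> Z)).
have -> : set_val \o restrict = f \o set_val by [].
move=> x; apply: continuous_comp; [exact: initial_continuous|exact: cf].
Qed.

Lemma restrict_sub x : tp_sub x -> tp_sub (restrict x).
Proof. exact: f2. Qed.

Definition restrict_pair : pair_map (subset_pair P) (subset_pair Q) :=
  PairMap restrict_continuous restrict_sub.
End SubsetPairs.

Definition acyclic_set (Y : topologicalType) (A : set Y) : Prop :=
  (exists f : {additive as_cohom (subset_pair (A, set0)) 0 -> int},
     bijective f) /\
  forall q, (0 < q)%N ->
    forall x : as_cohom (subset_pair (A, set0)) q, x = 0.

Record vietoris (G X : topologicalType) (p : G -> X) : Prop := Vietoris {
  vietoris_continuous : continuous p;
  vietoris_proper : forall K : set X, compact K -> compact (p @^-1` K);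
  vietoris_surjective : forall x, exists g, p g = x;
  vietoris_acyclic : forall x, acyclic_set (p @^-1` [set x]) }.

Record gmorphism (X : topologicalType) := Gmorphism {
  gm_space : topologicalType;
  gm_p : gm_space -> X;
  gm_q : gm_space -> X;
  gm_hausdorff : hausdorff_space gm_space;
  gm_vietoris : vietoris gm_p;
  gm_continuous : continuous gm_q }.
Arguments gm_p {X} g.
Arguments gm_q {X} g.
Arguments gm_vietoris {X} g.
Arguments gm_continuous {X} g.

Definition determined_by (X : topologicalType) (F : X -> set X)
  (m : gmorphism X) : Prop :=
  forall x, F x = gm_q m @` (gm_p m @^-1` [set x]).

Definition mimage (Y X : Type) (G : Y -> set X) (A : set Y) : set X :=
  \bigcup_(y in A) G y.

Definition usc (Y X : topologicalType) (G : Y -> set X) : Prop :=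
  forall B : set X, closed B -> closed [set y | G y `&` B !=set0].

Record is_dmds (X : topologicalType) (F : X -> int -> set X) : Prop := IsDmds {
  dmds_usc : usc (fun z : X * discrete_topology int => F z.1 z.2);
  dmds_compact : forall x n, compact (F x n);
  dmds_0 : forall x, F x 0 = [set x];
  dmds_add : forall x n m, 0 <= n * m ->
    mimage (F^~ m) (F x n) = F x (n + m);
  dmds_inv : forall x y, F x (-1) y <-> F y 1 x }.

Definition generator (X : Type) (F : X -> int -> set X) : X -> set X := F^~ 1.

Section IsolatedInvariantSets.
Variables (X : topologicalType) (F : X -> set X).

Definition Inv (N : set X) : set X :=
  [set x | N x /\ exists s : int -> X, [/\ forall n, N (s n), s 0 = x &
                    forall n, F (s n) (s (n + 1))]].

Definition isolating_neighbourhood (N : set X) : Prop :=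
  compact N /\ Inv N `<=` N°.

Definition isolated_invariant (S : set X) : Prop :=
  [/\ compact S, S = Inv S &
      exists2 N, isolating_neighbourhood N & S = Inv N].

Definition isolating_neighbourhood_for (S N : set X) : Prop :=
  isolating_neighbourhood N /\ S = Inv N.

Definition bdF (A : set X) : set X :=
  closure A `&` closure (mimage F A `\` A).

Record weak_index_pair (N : set X) (P : set X * set X) : Prop := WeakIndexPair {
  wip_compact1 : compact P.1;
  wip_compact2 : compact P.2;
  wip_sub21 : P.2 `<=` P.1;
  wip_sub1 : P.1 `<=` N;
  wip_invariant1 : mimage F P.1 `&` N `<=` P.1;
  wip_invariant2 : mimage F P.2 `&` N `<=` P.2;
  wip_exit : bdF P.1 `<=` P.2;
  wip_isolating : Inv N `<=` (P.1 `\` P.2)°;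
  wip_interior : P.1 `\` P.2 `<=` N° }.

Definition Tpair (N : set X) (P : set X * set X) : set X * set X :=
  (P.1 `|` ~` N°, P.2 `|` ~` N°).

Lemma mimage_Tpair1 N P : weak_index_pair N P ->
  mimage F P.1 `<=` (Tpair N P).1.
Proof.
move=> w y Fy; have [Ny|nNy] := pselect (N y).
  by left; exact: wip_invariant1 w _ (conj Fy Ny).
by right; apply: contra_not nNy; exact: interior_subset.
Qed.

Lemma mimage_Tpair2 N P : weak_index_pair N P ->
  mimage F P.2 `<=` (Tpair N P).2.
Proof.
move=> w y Fy; have [Ny|nNy] := pselect (N y).
  by left; exact: wip_invariant2 w _ (conj Fy Ny).
by right; apply: contra_not nNy; exact: interior_subset.
Qed.
End IsolatedInvariantSets.

(* For a compact pair P the map induced by restrict_p is bijective (Vietoris-Begle)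
   and for a weak index pair P so is the one induced by inclusion_T (strong
   excision), so additive_inv below is the actual inverse in these cases. *)
Section InducedByMultivaluedMap.
Variables (X : topologicalType) (F : X -> set X) (m : gmorphism X).
Hypothesis Fm : determined_by F m.

Definition gm_preimage (P : set X * set X) : set (gm_space m) * set (gm_space m) :=
  (gm_p m @^-1` P.1, gm_p m @^-1` P.2).

Definition restrict_p (P : set X * set X) :
    pair_map (subset_pair (gm_preimage P)) (subset_pair P) :=
  @restrict_pair _ _ (gm_preimage P) P (gm_p m)
    (vietoris_continuous (gm_vietoris m)) (fun _ h => h) (fun _ h => h).

Lemma sub_preimage_q (A B : set X) : mimage F A `<=` B ->
  gm_p m @^-1` A `<=` gm_q m @^-1` B.
Proof.
by move=> FAB g Ag; apply: FAB; exists (gm_p m g) => //; rewrite Fm; exists g.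
Qed.

Variables (P T : set X * set X).
Hypotheses (h1 : mimage F P.1 `<=` T.1) (h2 : mimage F P.2 `<=` T.2).

Definition restrict_q :
    pair_map (subset_pair (gm_preimage P)) (subset_pair T) :=
  @restrict_pair _ _ (gm_preimage P) T (gm_q m) (gm_continuous m)
    (sub_preimage_q h1) (sub_preimage_q h2).

Definition multi_cohom_map (q : nat) :
    {additive as_cohom (subset_pair T) q -> as_cohom (subset_pair P) q} :=
  zmod_comp (additive_inv (as_cohom_map (restrict_p P) q))
            (as_cohom_map restrict_q q).
End InducedByMultivaluedMap.

Section ConleyIndex.
Variables (X : topologicalType) (F : X -> set X) (m : gmorphism X).
Hypothesis Fm : determined_by F m.
Variables (N : set X) (P : set X * set X).
Hypothesis wP : weak_index_pair F N P.

Definition inclusion_T :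
    pair_map (subset_pair P) (subset_pair (Tpair N P)) :=
  @restrict_pair _ _ P (Tpair N P) id (fun=> cvg_id) (@subsetUl _ P.1 _)
    (@subsetUl _ P.2 _).

Definition index_map (q : nat) :
    {additive as_cohom (subset_pair P) q -> as_cohom (subset_pair P) q} :=
  zmod_comp
    (multi_cohom_map Fm (mimage_Tpair1 wP) (mimage_Tpair2 wP) q)
    (additive_inv (as_cohom_map inclusion_T q)).

Definition conley_index : gmod_endo := leray (GmodEndo index_map).
End ConleyIndex.

(* Main.v *)
Require Import Defs.
From mathcomp Require Import all_boot all_order all_algebra.
From mathcomp Require Import all_classical all_reals all_analysis.
From mathcomp Require Import ring lra zify.

(** The index map [I_P] is the homomorphism induced by [F] from [P] to [T(P)],
    composed with the inverse of the excision isomorphism.  Besides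
    functoriality, two theorems on cohomology make it manageable: strong
    excision ([excision_bij]) and the Vietoris-Begle theorem for compact pairs
    ([restrict_p_bij]).

    The comparison of two pairs rests on links.  If [P'] is contained in [P]
    and [F] maps [P] into [P'] up to the exit set, then the restriction
    [a : H^*(P) -> H^*(P')] and the map [b : H^*(P') -> H^*(P)] induced by [F]
    satisfy [b a = I_P] and [a b = I_P']; on the Leray reductions, where both
    composites are automorphisms, [a] is then an isomorphism
    ([leray_linked], [gen_index_link]).  The complement of the interior of the
    neighbourhood may be enlarged here to any closed set that meets [P_1] inside
    [P_2], because both index maps factor through the larger pair; so pairs
    belonging to different neighbourhoods can be linked as well.

    The dynamics enters through one compactness statement ([orbit_center]): a
    point of [N] in the middle of a long orbit in [N] is close to [Inv N].  Hence
    the middle points of long orbits lie in [P_1 \ P_2], and this property,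
    unlike a condition on interiors, is inherited by the pairs obtained from [P]
    by intersections and images.  Two pairs in the same [N] are compared
    with their intersection; for nested pairs, replacing the larger set
    repeatedly by the part reached from it by [F], together with the smaller
    set, reaches the smaller set after finitely many steps, each of which is a
    link ([npair_subset]).  In a smaller neighbourhood [K] of the same
    invariant set there is a pair linked to one in [N] ([npair_restrict]).
    The two given pairs are finally compared in the intersection of their
    neighbourhoods.

    For cohomology, the point is that Alexander-Spanier cochains are arbitrary
    functions.  They can be pulled back along any map, continuous or not, and a
    map that moves points only a little induces the identity, by the prism
    operator.  Strong excision follows by pushing a neighbourhood of [P_2] into
    [P_2].  For Vietoris-Begle, the cochains with vertices in both spaces, taken
    near the graph of [p], form a bicomplex whose edges are the two cochain
    complexes.  Its rows are contractible; its columns are exact because the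
    fibres are acyclic, first on a fibre with a scale that does not depend on
    the cocycle ([uniform_acyclicity]), then over a ball ([local_exact]), then
    everywhere ([column_exact]).  A zigzag through the bicomplex inverts the
    map induced by [p]. *)

Set Implicit Arguments.
Unset Strict Implicit.
Unset Printing Implicit Defensive.

Import Order.TTheory GRing.Theory Num.Theory.
Import Quotient.

Local Open Scope classical_set_scope.
Local Open Scope ring_scope.
Local Open Scope quotient_scope.

(** * Cochains on lists *)

(** The alternating sum over the omitted vertices, with the first vertex split
    off.  On lists the coboundary needs no index arithmetic; in degree 0 it is
    the augmentation. *)
Fixpoint delta (T : Type) (c : seq T -> int) (l : seq T) : int :=
  if l is x :: l' then c l' - delta (fun u => c (x :: u)) l' else 0.

Lemma delta_map (T T' : Type) (f : T -> T') c l :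
  delta (fun u => c (map f u)) l = delta c (map f l).
Proof. by elim: l c => //= y l IH c; rewrite (IH (fun u => c (f y :: u))). Qed.

Section ListCochains.
Variable T : Type.
Implicit Types (c e : seq T -> int) (l : seq T) (U : set T).

Fixpoint all_in U l : Prop := if l is x :: l' then U x /\ all_in U l' else True.

Lemma all_in_sub U U' l : U `<=` U' -> all_in U l -> all_in U' l.
Proof. by move=> UU'; elim: l => //= x l IH [/UU' ? /IH]. Qed.

Lemma all_inI U U' l : all_in U l -> all_in U' l -> all_in (U `&` U') l.
Proof. by elim: l => //= x l IH [? ?] [? ?]; split=> //; exact: IH. Qed.

Lemma all_in_cat U l l' : all_in U l -> all_in U l' -> all_in U (l ++ l').
Proof. by elim: l => //= x l IH [? ?] ?; split=> //; exact: IH. Qed.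

Lemma delta_ext c e l : (forall u, (size u).+1 = size l -> c u = e u) ->
  delta c l = delta e l.
Proof.
elim: l c e => //= x l IH c e ce; rewrite ce //; congr (_ - _).
by apply: IH => u ul; apply: ce; rewrite /= ul.
Qed.

Lemma delta_lin c e (n : int) l :
  delta (fun u => c u - n * e u) l = delta c l - n * delta e l.
Proof.
elim: l c e => [|x l IH] c e /=; first by rewrite mulr0 subr0.
by rewrite IH; ring.
Qed.

Lemma deltaB c e l : delta (fun u => c u - e u) l = delta c l - delta e l.
Proof.
by rewrite -[delta e l]mul1r -delta_lin; apply: delta_ext => u _; rewrite mul1r.
Qed.

Lemma deltaZ c (n : int) l : delta (fun u => n * c u) l = n * delta c l.
Proof.
elim: l c => [|x l IH] c /=; first by rewrite mulr0.
by rewrite IH; ring.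
Qed.

Lemma delta_vanish U c l : (forall u, (size u).+1 = size l -> all_in U u -> c u = 0) ->
  all_in U l -> delta c l = 0.
Proof.
elim: l c => //= x l IH c c0 [Ux Ul]; rewrite c0 // IH ?subr0 // => u ul Uu.
by apply: c0; rewrite /= ?ul.
Qed.

Lemma delta0 l : delta (fun=> 0) l = 0.
Proof. by apply: (@delta_vanish setT) => //; elim: l. Qed.

Lemma delta_delta c l : delta (delta c) l = 0.
Proof.
elim: l c => //= x l IH c.
by rewrite deltaB IH subr0 subrr.
Qed.

Lemma delta_cat c l l' : delta c (l ++ l') =
  delta (fun u => c (u ++ l')) l + (-1) ^+ size l * delta (fun u => c (l ++ u)) l'.
Proof.
elim: l c => [|x l IH] c /=; first by rewrite add0r mul1r.
by rewrite IH exprS; ring.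
Qed.

(** The prism operator of a self-map [r] that is close to the identity: it
    is a cochain homotopy between the identity and the pullback by [r], and no
    continuity of [r] is involved. *)
Fixpoint prism (r : T -> T) c l : int :=
  if l is x :: l' then
    c (x :: r x :: map r l') - prism r (fun u => c (x :: u)) l'
  else 0.

Lemma prismB r c e l : prism r (fun u => c u - e u) l = prism r c l - prism r e l.
Proof.
by elim: l c e => [|x l IH] c e /=; rewrite ?subr0 // IH; ring.
Qed.

Lemma prism_vanish r U c l :
  (forall u, size u = (size l).+1 -> all_in U u -> c u = 0) ->
  all_in U l -> all_in U (map r l) -> prism r c l = 0.
Proof.
elim: l c => //= x l IH c c0 [Ux Ul] [Urx Url].
rewrite c0 /= ?size_map // IH ?subr0 // => u ul Uu.
by apply: c0; rewrite /= ?ul.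
Qed.

Lemma prismP r c l : delta (prism r c) l + prism r (delta c) l = c (map r l) - c l.
Proof.
elim: l c => [|x l IH] c /=; first by rewrite [RHS]subrr.
rewrite deltaB prismB.
have -> : delta (fun u => c (x :: r x :: map r u)) l =
          delta (fun u => c (x :: r x :: u)) (map r l).
  exact: (delta_map r (fun u => c (x :: r x :: u))).
by have := IH (fun v => c (x :: v)); lia.
Qed.

End ListCochains.

Lemma all_in_map (T T' : Type) (f : T -> T') U l : all_in U (map f l) <->
  all_in (f @^-1` U) l.
Proof. by elim: l => //= x l IH; split=> -[? /IH]. Qed.

(** * A zigzag argument in a bicomplex with exact columns *)

Section Zigzag.
Variables (V : zmodType) (dh dv : V -> V) (Z1 Z2 : nat -> nat -> V -> Prop).
Hypotheses (dhB : forall x y, dh (x - y) = dh x - dh y)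
  (dvB : forall x y, dv (x - y) = dv x - dv y)
  (dhdv : forall x, dh (dv x) = - dv (dh x))
  (dhdh : forall x, dh (dh x) = 0).
Hypotheses (Z1B : forall a b x y, Z1 a b x -> Z1 a b y -> Z1 a b (x - y))
  (Z2B : forall a b x y, Z2 a b x -> Z2 a b y -> Z2 a b (x - y))
  (Z1h : forall a b x, Z1 a b x -> Z1 a.+1 b (dh x))
  (Z2h : forall a b x, Z2 a b x -> Z2 a.+1 b (dh x)).
Hypothesis exact0 : forall a x, Z1 a.+1 1 (dv x) -> Z1 a.+1 0 x.
Hypothesis exactS : forall a b x, Z2 a.+1 b.+1 x -> Z1 a.+1 b.+2 (dv x) ->
  exists2 y, Z2 a.+1 b y & Z1 a.+1 b.+1 (x - dv y).

Let Z10 a b x : Z1 a b x -> Z1 a b 0.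
Proof. by move=> zx; rewrite -(subrr x); exact: Z1B. Qed.

Let Z1N a b x : Z1 a b x -> Z1 a b (- x).
Proof. by move=> zx; rewrite -sub0r; apply: Z1B => //; apply: Z10 zx. Qed.

(** A total cocycle of degree [n] up to its two extreme differentials: the term
    [eta k] sits in bidegree [(k, n - k)].  The groups of the bicomplex are the
    elements satisfying [Z2], modulo those satisfying [Z1]. *)
Definition zigzag n (eta : nat -> V) : Prop :=
  (forall k, (k <= n)%N -> Z2 k (n - k) (eta k)) /\
  (forall k, (k < n)%N -> Z1 k.+1 (n - k) (dh (eta k) + dv (eta k.+1))).

(** A primitive travels along the zigzag: its horizontal differential, subtracted
    from the next term, leaves a vertical cocycle, which has a vertical
    primitive again. *)
Lemma zigzag_bounds n eta zeta : zigzag n.+1 eta ->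
  Z2 0 n zeta -> Z1 0 n.+1 (eta 0%N - dv zeta) ->
  exists2 xi, Z2 n 0 xi & Z1 n.+1 0 (eta n.+1 - dh xi).
Proof.
move=> [eta2 eta1] zeta2 zeta1.
have step k : (k <= n)%N -> exists2 xi, Z2 k (n - k) xi &
    Z1 k.+1 (n.+1 - k) (dh (eta k) + dv (dh xi)).
  elim: k => [|k IH] kn.
    exists zeta; rewrite ?subn0 //.
    have := Z1h zeta1; rewrite dhB dhdv opprK.
    by [].
  have [xi xi2 xi1] := IH (ltnW kn).
  have e1 := Z1B (eta1 k (ltnW kn : (k < n.+1)%N)) xi1.
  have nk : (n.+1 - k = (n - k.+1).+2)%N by lia.
  have [||y y2 y1] := @exactS k (n - k.+1)%N (eta k.+1 - dh xi).
  - apply: Z2B; last by apply: Z2h; have -> : (n - k.+1).+1 = (n - k)%N by lia.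
    have -> : (n - k.+1).+1 = (n.+1 - k.+1)%N by lia.
    by apply: eta2; lia.
  - by move: e1; rewrite opprD addrACA subrr add0r -dvB nk.
  exists y => //; have := Z1h y1.
  have -> : (n.+1 - k.+1 = (n - k.+1).+1)%N by lia.
  by rewrite !dhB dhdh subr0 dhdv opprK.
have [xi xi2 xi1] := step n (leqnn n).
exists xi; first by rewrite subnn in xi2.
have := Z1B (eta1 n (ltnSn n)) xi1; rewrite subSnn => e1.
by apply: exact0; move: e1; rewrite opprD addrACA subrr add0r -dvB.
Qed.

(** The horizontal differential of each term is a vertical cocycle since the
    differentials anticommute; its vertical primitive is the next term. *)
Lemma zigzag_exists n x : (0 < n)%N -> Z2 0 n x -> Z1 0 n.+1 (dv x) ->
  exists2 eta, zigzag n eta & eta 0%N = x /\ Z1 n.+1 0 (dh (eta n)).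
Proof.
move=> n0 x2 x1.
have step k : (k <= n)%N -> exists2 eta : nat -> V,
    (forall j, (j <= k)%N -> Z2 j (n - j) (eta j)) /\
    (forall j, (j < k)%N -> Z1 j.+1 (n - j) (dh (eta j) + dv (eta j.+1))) &
    eta 0%N = x /\ Z1 k.+1 (n - k).+1 (dv (dh (eta k))).
  elim: k => [|k IH] kn.
    exists (fun=> x); first by split=> // j; rewrite leqn0 => /eqP ->; rewrite subn0.
    split=> //; have := Z1N (Z1h x1); rewrite dhdv opprK subn0.
    by [].
  have [eta [eta2 eta1] [eta0 etak]] := IH (ltnW kn).
  have nk : (n - k = (n - k.+1).+1)%N by lia.
  have [||y y2 y1] := @exactS k (n - k.+1)%N (dh (eta k)).
  - by rewrite -nk; apply/Z2h/eta2.
  - by rewrite -nk.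
  have y2N : Z2 k.+1 (n - k.+1) (- y).
    by rewrite -sub0r; apply: Z2B => //; rewrite -(subrr y); apply: Z2B.
  exists (fun j => if (j <= k)%N then eta j else - y).
    split=> j; first by rewrite leq_eqVlt => /predU1P[->|];
      rewrite ?ltnn // ltnS => jk; rewrite jk; exact: eta2.
    rewrite ltnS => jk; rewrite jk; move: jk; rewrite leq_eqVlt.
    move=> /predU1P[->|jk]; last by rewrite jk; exact: eta1.
    rewrite ltnn nk; have -> : dv (- y) = - dv y.
      by rewrite -[- y]sub0r dvB -[X in dv X](subrr y) dvB subrr sub0r.
    by [].
  split=> //; rewrite ltnn.
  have := Z1h y1; rewrite dhB dhdh sub0r dhdv opprK.
  have -> : dh (- y) = - dh y.
    by rewrite -[- y]sub0r dhB -[X in dh X](subrr y) dhB subrr sub0r.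
  have -> : dv (- dh y) = - dv (dh y).
    by rewrite -[- dh y]sub0r dvB -[X in dv X](subrr y) dvB subrr sub0r.
  by move=> /Z1N.
have [eta [eta2 eta1] [eta0 etan]] := step n (leqnn n).
by exists eta => //; split=> //; apply: exact0; move: etan; rewrite subnn.
Qed.

End Zigzag.

(** * Alexander-Spanier cohomology through cochains on lists *)

Definition loc_zero (T : topologicalType) (A : set T) n (c : seq T -> int) : Prop :=
  forall x, A x -> exists2 U, nbhs x U &
    forall l, size l = n -> all_in (U `&` A) l -> c l = 0.

(** In degree 0 the only list is the empty one; requiring the value 0 there
    keeps the augmentation out, so that unreduced cohomology is computed. *)
Definition loc_zero_aug (T : topologicalType) (A : set T) n (c : seq T -> int) : Prop :=
  loc_zero A n c /\ (n = 0%N -> c [::] = 0).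

Section LocallyZero.
Variable T : topologicalType.
Implicit Types (A B : set T) (c e : seq T -> int).

Lemma loc_zero_lin A n c e (k : int) : loc_zero A n c -> loc_zero A n e ->
  loc_zero A n (fun l => c l - k * e l).
Proof.
move=> hc he x Ax; have [U xU cU] := hc x Ax; have [V xV eV] := he x Ax.
exists (U `&` V); first exact: filterI.
move=> l ln UVl; rewrite cU ?eV ?mulr0 ?subr0 //.
  by apply: all_in_sub UVl => y [[]].
by apply: all_in_sub UVl => y [[]].
Qed.

Lemma loc_zero_ext A n c e : (forall l, size l = n -> c l = e l) -> loc_zero A n c ->
  loc_zero A n e.
Proof.
move=> ce hc x Ax; have [U xU cU] := hc x Ax.
by exists U => // l ln Ul; rewrite -ce // cU.
Qed.

Lemma loc_zeroB A n c e : loc_zero A n c -> loc_zero A n e ->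
  loc_zero A n (fun l => c l - e l).
Proof.
move=> hc he; apply: loc_zero_ext (loc_zero_lin 1 hc he) => l _.
by rewrite mul1r.
Qed.

Lemma loc_zero_0 A n : loc_zero A n (fun=> 0).
Proof. by move=> x _; exists setT => //; exact: filterT. Qed.

Lemma loc_zeroN A n c : loc_zero A n c -> loc_zero A n (fun l => - c l).
Proof.
move=> /(loc_zeroB (@loc_zero_0 A n)) hc; apply: loc_zero_ext hc => l _.
by rewrite sub0r.
Qed.

End LocallyZero.

(** Lists of length [n] are simplices of dimension [n - 1], so [n] exceeds the
    degree in cohomology by one. *)
Definition rel_cocycle (T : topologicalType) (P : set T * set T) n (c : seq T -> int) :=
  loc_zero P.2 n c /\ loc_zero P.1 n.+1 (delta c).

Definition rel_coboundary (T : topologicalType) (P : set T * set T) n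
    (c : seq T -> int) :=
  exists2 e, loc_zero_aug P.2 n.-1 e & loc_zero P.1 n (fun l => c l - delta e l).

Definition tuple_cochain (T : Type) q (c : seq T -> int) : cochain T q :=
  fun t => c (codom t).
Arguments tuple_cochain {T} q c.

Definition list_cochain (T : Type) q (psi : cochain T q) : seq T -> int :=
  fun l => if l is x :: _ then psi (fun i => nth x l i) else 0.
Arguments list_cochain {T q} psi.

Section TupleList.
Variable T : topologicalType.

Lemma nth_codom_ord q (t : 'I_q -> T) x (i : 'I_q) : nth x (codom t) i = t i.
Proof. by rewrite (nth_map i) ?size_enum_ord // nth_ord_enum. Qed.

Lemma codom_cons q (t : 'I_q.+1 -> T) :
  codom t = t ord0 :: codom (t \o lift ord0).
Proof. by rewrite /codom /image_mem enum_ordSl /= -map_comp. Qed.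

Lemma list_cochainK q (psi : cochain T q) : tuple_cochain q (list_cochain psi) = psi.
Proof.
apply/funext => t; rewrite /tuple_cochain /list_cochain.
have : codom t = t ord0 :: codom (t \o lift ord0) by exact: codom_cons.
case E : (codom t) => [|x s] // _; congr psi; apply/funext => i.
by rewrite -E nth_codom_ord.
Qed.

Lemma codom_nth q (l : seq T) x : size l = q -> codom (fun i : 'I_q => nth x l i) = l.
Proof.
move=> lq; apply: (@eq_from_nth _ x); first by rewrite size_codom card_ord.
move=> i; rewrite size_codom card_ord => iq.
by rewrite (nth_codom_ord _ x (Ordinal iq)).
Qed.

Lemma coboundary_tuple q (c : seq T -> int) : coboundary (tuple_cochain q c) =
  tuple_cochain q.+1 (delta c).
Proof.
apply/funext => t; rewrite /coboundary /tuple_cochain.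
elim: q c t => [|q IH] c t.
  rewrite 2!big_ord_recl big_ord0 /= expr0 mul1r addr0 expr1 mulN1r.
  rewrite !codom_cons /=.
  have e0 (s : 'I_0 -> T) : codom s = [::] :> seq T by apply/eqP;
    rewrite -size_eq0 size_codom card_ord.
  rewrite !e0 /= subr0; congr (c [:: _] - c [:: t _]).
  by apply/val_inj.
rewrite big_ord_recl /= expr0 mul1r [in RHS]codom_cons /=; congr (_ + _).
rewrite -(IH (fun u => c (t ord0 :: u))) -sumrN; apply: eq_bigr => i _.
rewrite /= /bump /= exprS mulN1r mulNr; congr (- (_ * _)).
rewrite codom_cons; congr (c (_ :: _)); first by congr t; exact: val_inj.
apply: eq_codom => j /=; congr t; apply: val_inj => /=.
by rewrite /bump /= !add1n ltnS addnS.
Qed.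

Lemma loc_zero_tuple (A : set T) q (c : seq T -> int) :
  locally_zero A (tuple_cochain q c) <-> loc_zero A q.+1 c.
Proof.
have linP (U : set T) n (t : 'I_n -> T) : (forall i, U (t i)) <-> all_in U (codom t).
  elim: n t => [|n IH] t.
    by split=> [_|_ []//]; rewrite (_ : codom t = [::]) //; apply/eqP;
      rewrite -size_eq0 size_codom card_ord.
  rewrite codom_cons /=; split=> [Ut|[U0 /IH Ut] i]; first by split;
    [|apply/IH => i; exact: Ut].
  by case: (unliftP ord0 i) => [j ->|->] //; exact: Ut.
split=> h x Ax; have [U xU hU] := h x Ax; exists U => //.
  move=> l ln Ul; case: l ln Ul => // y l [ln] Ul.
  rewrite -(@codom_nth q.+1 (y :: l) y) /= ?ln //; apply: hU; apply/linP.
  by rewrite codom_nth //= ln.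
move=> t /linP Ut; apply: hU => //.
by rewrite size_codom card_ord.
Qed.

Lemma tuple_cochain_pullback (T' : topologicalType) (f : T' -> T) q (c : seq T -> int) :
  cochain_pullback f (tuple_cochain q c) = tuple_cochain q (fun l => c (map f l)).
Proof. by apply/funext => t;
  rewrite /tuple_cochain /cochain_pullback /codom /image_mem map_comp. Qed.

End TupleList.

Lemma as_cohom0 (P : toppair) q (z : subgrp (as_cocycle P q)) :
  (\pi_(as_cohom P q) z = 0) <-> cobounds (val z).
Proof.
have -> : (\pi_(as_cohom P q) z = 0) <-> z \in as_coboundary P q.
  rewrite -{2}[z]subr0 idealrBE raddf0.
  by split=> [->//|/eqP].
by split=> [/set_predP|h] //; apply/set_predP.
Qed.

Definition full_pair (P : toppair) : set P * set P := (setT, @tp_sub P).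

Lemma rel_cocycle_tuple (P : toppair) q (c : seq P -> int) :
  tuple_cochain q c \in as_cocycle P q <-> rel_cocycle (full_pair P) q.+1 c.
Proof.
split=> [/set_predP [/loc_zero_tuple h1]|[/loc_zero_tuple h1 h2]].
  by rewrite coboundary_tuple => /loc_zero_tuple.
by apply/set_predP; split=> //; rewrite coboundary_tuple; apply/loc_zero_tuple.
Qed.

Lemma cobounds_tuple (P : toppair) q (c : seq P -> int) :
  cobounds (tuple_cochain q c) <-> rel_coboundary (full_pair P) q.+1 c.
Proof.
rewrite /cobounds /rel_coboundary /=; case: q => [|q] /=; split.
- move=> /loc_zero_tuple h; exists (fun=> 0); first by split=> //; exact: loc_zero_0.
  by apply: loc_zero_ext h => l _; rewrite delta0 subr0.
- move=> [e [_ e0] h]; apply/loc_zero_tuple; apply: loc_zero_ext h =>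
    -[|x [|y l]] //= _.
  by rewrite subr0 e0 // subr0.
- move=> [psi psi1]; rewrite -[psi]list_cochainK coboundary_tuple => psi2.
  exists (list_cochain psi); first by split=> //; apply/loc_zero_tuple;
    rewrite list_cochainK.
  by apply/loc_zero_tuple.
- move=> [e [e1 _] e2]; exists (tuple_cochain q e); first by apply/loc_zero_tuple.
  by rewrite coboundary_tuple; exact:
    (@loc_zero_tuple _ setT q.+1 (fun l => c l - delta e l)).2 e2.
Qed.

Lemma as_cohom_repr (P : toppair) q (x : as_cohom P q) : exists2 c : seq P -> int,
  rel_cocycle (full_pair P) q.+1 c &
  exists2 z : subgrp (as_cocycle P q), val z = tuple_cochain q c & x =
    \pi_(as_cohom P q) z.
Proof.
exists (list_cochain (val (repr x))).
  by apply/rel_cocycle_tuple; rewrite list_cochainK; exact: valP.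
by exists (repr x); rewrite ?list_cochainK ?reprK.
Qed.

Section PairMap.
Variables (P Q : toppair) (f : pair_map P Q) (q : nat).

Lemma as_cohom_map_pi z : as_cohom_map f q (\pi_(as_cohom Q q) z) =
  \pi_(as_cohom P q) (cocycle_pullback f q z).
Proof. exact: quot_map_pi. Qed.

Lemma as_cohom_map_bij :
  (forall c, rel_cocycle (full_pair Q) q.+1 c ->
     rel_coboundary (full_pair P) q.+1 (fun l => c (map f l)) ->
       rel_coboundary (full_pair Q) q.+1 c) ->
  (forall c, rel_cocycle (full_pair P) q.+1 c ->
     exists2 d, rel_cocycle (full_pair Q) q.+1 d &
       rel_coboundary (full_pair P) q.+1 (fun l => c l - d (map f l))) ->
  bijective (as_cohom_map f q).
Proof.
move=> inj surj.
have ker0 x : as_cohom_map f q x = 0 -> x = 0.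
  have [c cc [z zc ->]] := as_cohom_repr x.
  rewrite as_cohom_map_pi => /as_cohom0 /=; rewrite zc tuple_cochain_pullback.
  by move=> /cobounds_tuple /(inj _ cc) /cobounds_tuple h; apply/as_cohom0; rewrite zc.
have injf : injective (as_cohom_map f q).
  by move=> x y xy; apply/subr0_eq/ker0; rewrite raddfB; apply/eqP; rewrite subr_eq0;
    apply/eqP.
have surjf y : exists x, as_cohom_map f q x = y.
  have [c cc [z zc ->]] := as_cohom_repr y.
  have [d /rel_cocycle_tuple dc cd] := surj c cc.
  exists (\pi_(as_cohom Q q) (Subgrp dc)); rewrite as_cohom_map_pi.
  apply/esym/subr0_eq; rewrite -raddfB; apply/as_cohom0.
  rewrite raddfB /= zc tuple_cochain_pullback.
  exact: (@cobounds_tuple P q (fun l => c l - d (map f l))).2 cd.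
have [g gK] := choice surjf.
by exists g => // x; apply: injf; rewrite gK.
Qed.

End PairMap.

Lemma as_cohom_map_comp (P Q S : toppair) (f : pair_map P Q) (g : pair_map Q S)
    (h : pair_map P S) q x : (forall y, h y = g (f y)) ->
  as_cohom_map h q x = as_cohom_map f q (as_cohom_map g q x).
Proof.
move=> hgf; have -> : x = \pi_(as_cohom S q) (repr x) by rewrite reprK.
rewrite !as_cohom_map_pi; congr (\pi_(as_cohom P q) _); apply: val_inj => /=.
apply/funext => t; rewrite /cochain_pullback; congr (val (repr x) _).
by apply/funext => i /=; rewrite hgf.
Qed.

(** * Subsets of an ambient space *)

Section Subset.
Variables (T : topologicalType) (B : set T).

Definition ext (e : seq (set_type B) -> int) : seq T -> int :=
  fun l => e (pmap insub l).

Lemma extK e : (fun l => ext e (map set_val l)) = e.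
Proof.
apply/funext => l; rewrite /ext; congr e.
by apply: map_pK => x; rewrite valK.
Qed.

Lemma all_in_val (l : seq T) : all_in B l -> exists l' : seq (set_type B), l =
  map set_val l'.
Proof.
elim: l => [_|x l IH] /=; first by exists [::].
by move=> [Bx /IH[l' ->]]; exists (exist _ x (mem_set Bx) :: l').
Qed.

Lemma loc_zero_val A n (c : seq T -> int) : A `<=` B ->
  loc_zero (set_val @^-1` A : set (set_type B)) n (fun l => c (map set_val l)) <->
    loc_zero A n c.
Proof.
move=> AB; split=> h.
  move=> x Ax; pose x' : set_type B := exist _ x (mem_set (AB x Ax)).
  have [U + cU] := h x' Ax; rewrite nbhsE => -[W [[V oV <-] Vx] WU].
  exists V; first exact: open_nbhs_nbhs.
  move=> l ln Vl; have /all_in_val[l' ll'] : all_in B l by apply: all_in_sub Vl =>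
    y [_ /AB].
  rewrite ll' in ln Vl *; apply: cU; first by rewrite size_map in ln.
  by move/all_in_map: Vl; apply: all_in_sub => y [Vy Ay]; split=> //; exact: WU.
move=> x Ax; have [U xU cU] := h _ Ax.
exists (set_val @^-1` U); first exact: initial_continuous.
move=> l ln Ul; apply: cU; first by rewrite size_map.
exact/all_in_map.
Qed.

End Subset.

Section SubsetPair.
Variables (T : topologicalType) (P : set T * set T).
Hypothesis P21 : P.2 `<=` P.1.

Let loc_zero_val1 n (c : seq T -> int) :
  loc_zero [set: set_type P.1] n (fun l => c (map set_val l)) <-> loc_zero P.1 n c.
Proof.
rewrite -(@loc_zero_val _ P.1 P.1) //; suff -> : set_val @^-1` P.1 =
  [set: set_type P.1] by [].
by apply/seteqP; split=> // x _; exact: set_valP.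
Qed.

Lemma rel_cocycle_val n (c : seq T -> int) :
  rel_cocycle (full_pair (subset_pair P)) n (fun l => c (map set_val l)) <->
    rel_cocycle P n c.
Proof.
rewrite /rel_cocycle /=; have -> : delta (fun l => c (map (@set_val _ P.1) l)) =
    fun l => delta c (map set_val l) by apply/funext => l; rewrite delta_map.
by rewrite loc_zero_val1 -(@loc_zero_val _ P.1 P.2).
Qed.

Lemma rel_coboundary_val n (c : seq T -> int) :
  rel_coboundary (full_pair (subset_pair P)) n (fun l => c (map set_val l)) <->
    rel_coboundary P n c.
Proof.
split=> -[e [e1 e0] e2].
  exists (ext e); first split.
  - by rewrite -(@loc_zero_val _ P.1 P.2) // extK.
  - exact: e0.
  - rewrite -loc_zero_val1; apply: loc_zero_ext e2 => l _.
    by rewrite -delta_map extK.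
exists (fun l => e (map set_val l)); first by split=> //; apply/loc_zero_val.
by move/loc_zero_val1: e2; apply: loc_zero_ext => l _; rewrite delta_map.
Qed.

End SubsetPair.

Section RestrictPair.
Variables (Y Z : topologicalType).
Variables (P : set Y * set Y) (Q : set Z * set Z) (f : Y -> Z).
Hypotheses (cf : continuous f) (f1 : P.1 `<=` f @^-1` Q.1)
  (f2 : P.2 `<=` f @^-1` Q.2).

(** Reduces isomorphism statements about cohomology to cochains on lists in the
    ambient spaces, where no subset types occur. *)
Lemma restrict_pair_bij q : P.2 `<=` P.1 -> Q.2 `<=` Q.1 ->
  (forall c, rel_cocycle Q q.+1 c -> rel_coboundary P q.+1 (fun l => c (map f l)) ->
    rel_coboundary Q q.+1 c) ->
  (forall c, rel_cocycle P q.+1 c -> exists2 d, rel_cocycle Q q.+1 d &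
     rel_coboundary P q.+1 (fun l => c l - d (map f l))) ->
  bijective (as_cohom_map (restrict_pair cf f1 f2) q).
Proof.
move=> P21 Q21 inj surj.
have mapE (c : seq Z -> int) (l : seq (set_type P.1)) :
    c (map set_val (map (restrict_pair cf f1 f2) l)) = c (map f (map set_val l)).
  by rewrite -!map_comp.
apply: as_cohom_map_bij => c.
  rewrite -[c]extK => /(rel_cocycle_val Q21) cc.
  have -> : (fun l => ext c (map set_val (map (restrict_pair cf f1 f2) l))) =
    fun l : seq (set_type P.1) => ext c (map f (map set_val l)).
    by apply/funext => l; exact: mapE.
  move=> h; have {}h := (rel_coboundary_val P21 q.+1 (fun l => ext c (map f l))).1 h.
  by apply/(rel_coboundary_val Q21); exact: inj.
rewrite -[c]extK => /(rel_cocycle_val P21) /surj[d /(rel_cocycle_val Q21) dd cd].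
exists (fun l => d (map set_val l)) => //.
have -> : (fun l => ext c (map set_val l) - d (map set_val (map (restrict_pair cf f1 f2) l))) =
    fun l : seq (set_type P.1) => (fun u => ext c u - d (map f u)) (map set_val l).
  by apply/funext => l; rewrite mapE.
exact: (rel_coboundary_val P21 q.+1 (fun u => ext c u - d (map f u))).2 cd.
Qed.

End RestrictPair.

(** * Strong excision *)

Definition addC (T : Type) (P : set T * set T) (C : set T) : set T * set T :=
  (P.1 `|` C, P.2 `|` C).

(** A Lebesgue number. *)
Lemma loc_zero_uniform (R : realType) (X : metricType R) (K A : set X) n c :
  compact K -> K `<=` A -> loc_zero A n c ->
  exists2 eps : R, 0 < eps & forall x, K x -> forall l, size l = n ->
    all_in (ball x eps `&` A) l -> c l = 0.
Proof.
move=> /compact_near_coveringP cK KA hc.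
have : \forall e \near (0 : R)^'+, forall x, K x -> forall l, size l = n ->
    all_in (ball x e `&` A) l -> c l = 0.
  apply: cK => x /KA /hc [U + cU]; rewrite -nbhs_ballE => -[d /= d0 dU].
  exists (ball x (d / 2), [set e | e < d / 2]) => /=.
    split; last by apply: nbhs_right_lt; rewrite divr_gt0.
    by apply: nbhsx_ballx; rewrite divr_gt0.
  move=> [y e] /= [xy ed] l ln yl; apply: cU => //.
  apply: all_in_sub yl => z [yz Az]; split=> //; apply: dU => /=.
  rewrite (splitr d); apply: ball_triangle xy _.
  exact: le_ball (ltW ed) _ yz.
move=> H; near (0 : R)^'+ => e.
by exists e; [near: e; exact: nbhs_right_gt | near: e].
Unshelve. all: by end_near. Qed.

Section Excision.
Variables (R : realType) (X : metricType R) (P : set X * set X) (C : set X).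
Hypotheses (cP1 : compact P.1) (cP2 : compact P.2) (P21 : P.2 `<=` P.1)
  (clC : closed C) (PC : P.1 `&` C `<=` P.2).

(** Discontinuous at distance [eps] from [P.2], but no point moves by more than
    [eps]. *)
Definition push (eps : R) (x : X) : X :=
  if `[< P.1 x /\ exists2 y, P.2 y & ball x eps y >]
  then xget x [set y | P.2 y /\ ball x eps y] else x.

Variable eps : R.
Hypothesis eps0 : 0 < eps.
Let r := push (eps / 2).

Lemma push_near x y : P.1 x -> P.2 y -> ball y (eps / 2) x -> P.2 (r x).
Proof.
move=> Px Py xy; rewrite /r /push asboolT; last first.
  by split=> //; exists y => //; exact: ball_sym.
case: xgetP => [z _ []//|/(_ y)]; case; split=> //.
exact: ball_sym.
Qed.

Lemma push_id x : ~ P.1 x -> r x = x.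
Proof. by move=> nP; rewrite /r /push asboolF // => -[]. Qed.

Lemma push_ball x : ball x (eps / 2) (r x).
Proof.
rewrite /r /push; case: asboolP => [[Px [y Py xy]]|_].
  by case: xgetP => [z _ []//|/(_ y)]; case.
by apply: ballxx; rewrite divr_gt0.
Qed.

Lemma push_P2 x : P.2 x -> P.2 (r x).
Proof.
move=> Px; apply: (@push_near x x) => //; first exact: P21.
by apply: ballxx; rewrite divr_gt0.
Qed.

Lemma push_P1 x : P.1 x -> P.1 (r x).
Proof.
move=> Px; rewrite /r /push; case: asboolP => [[_ [y Py xy]]|_] //.
by case: xgetP => [z _ [/P21]//|/(_ y)]; case.
Qed.

Lemma push_C x : C x -> (P.2 `|` C) (r x).
Proof.
move=> Cx; have [Px|Px] := pselect (P.1 x).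
  by left; apply: push_P2; exact: PC.
by rewrite push_id //; right.
Qed.

Lemma push_balls x y : ball x (eps / 2) y -> ball x eps y /\ ball x eps (r y).
Proof.
move=> xy; split; first by apply: le_ball xy;
  rewrite ler_pdivrMr // ler_peMr ?ler1n // ltW.
by rewrite (splitr eps); apply: ball_triangle xy _; exact: push_ball.
Qed.

Lemma nbhs_notP1 x : ~ P.1 x -> nbhs x (~` P.1).
Proof.
move=> nP; apply: open_nbhs_nbhs; split=> //; apply: closed_openC.
by apply: compact_closed => //; exact: metric_hausdorff.
Qed.

Lemma all_in_push (A B : set X) x l : (forall y, A y -> B (r y)) ->
  all_in (ball x (eps / 2) `&` A) l -> all_in (ball x eps `&` B) (map r l).
Proof.
by move=> AB h; apply/all_in_map; apply: all_in_sub h => y [/push_balls[_ xy] /AB ?].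
Qed.

Lemma all_in_half (A : set X) x l :
  all_in (ball x (eps / 2) `&` A) l -> all_in (ball x eps `&` A) l.
Proof. by apply: all_in_sub => y [/push_balls[xy _] ?]. Qed.

(** The pullback of a cochain on [P.1] by [push], extended by 0: it is a
    relative cochain of the enlarged pair because [push] sends a neighbourhood
    of [P.2] in [P.1] into [P.2]. *)
Definition push_ext (c : seq X -> int) l : int :=
  if `[< all_in P.1 l >] then c (map r l) else 0.

Lemma push_ext_in c l : all_in P.1 l -> push_ext c l = c (map r l).
Proof. by move=> h; rewrite /push_ext asboolT. Qed.

Lemma push_ext_delta c l : all_in P.1 l -> delta (push_ext c) l = delta c (map r l).
Proof.
move=> Pl; rewrite -delta_map; apply/eqP; rewrite -subr_eq0 -deltaB; apply/eqP.
by apply: delta_vanish Pl => u _ Pu; rewrite push_ext_in // subrr.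
Qed.

(** Close to [P.2] every vertex is pushed into [P.2], where the cochain is
    locally zero; close to a point of [C] outside [P.1] no nonempty
    list lies in [P.1]. *)
Lemma push_ext_loc_zero n c :
  (forall x, P.2 x -> forall l, size l = n ->
    all_in (ball x eps `&` P.2) l -> c l = 0) ->
  (n = 0%N -> c [::] = 0) ->
  forall x, (P.2 `|` C) x -> exists2 U, nbhs x U & forall l, size l = n ->
    all_in U l -> push_ext c l = 0.
Proof.
move=> hc c0 x PCx; have [Px|nPx] := pselect (P.1 x).
  have {PCx} P2x : P.2 x by case: PCx => // Cx; exact: PC.
  exists (ball x (eps / 2)); first by apply: nbhsx_ballx; rewrite divr_gt0.
  move=> l ln xl; rewrite /push_ext; case: asboolP => // Pl.
  apply: (hc x) => //; first by rewrite size_map.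
  apply/all_in_map; apply: all_in_sub (all_inI xl Pl) => y [xy Py].
  by split; [have [] := push_balls xy|exact: push_near xy].
exists (~` P.1); first exact: nbhs_notP1.
move=> l ln nPl; rewrite /push_ext; case: asboolP => // Pl.
case: l ln nPl Pl => [/esym ln _ _|y l _ [nPy _] [Py _]]; first exact: c0.
by have := nPy Py.
Qed.

End Excision.

Section ExcisionBij.
Variables (R : realType) (X : metricType R) (P : set X * set X) (C : set X).
Hypotheses (cP1 : compact P.1) (cP2 : compact P.2) (P21 : P.2 `<=` P.1)
  (clC : closed C) (PC : P.1 `&` C `<=` P.2).

(** The extension of a cocycle by [push_ext] restricts to its pullback by [push],
    which the prism operator makes cohomologous to the cocycle itself. *)
Lemma excision_surj q c : rel_cocycle P q.+1 c -> exists2 d,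
  rel_cocycle (addC P C) q.+1 d &
  rel_coboundary P q.+1 (fun l => c l - d l).
Proof.
move=> [c2 c1]; have [e2 e20 ce2] := loc_zero_uniform cP2 (@subset_refl _ _) c2.
have [e1 e10 ce1] := loc_zero_uniform cP1 (@subset_refl _ _) c1.
pose eps := Order.min e1 e2.
have eps0 : 0 < eps by rewrite lt_min e10.
have le1 : eps <= e1 by rewrite ge_min lexx.
have le2 : eps <= e2 by rewrite ge_min lexx orbT.
have {}ce2 x : P.2 x -> forall l, size l = q.+1 ->
    all_in (ball x eps `&` P.2) l -> c l = 0.
  move=> Px l ln xl; apply: (ce2 x) => //; apply: all_in_sub xl => y [xy ?].
  by split=> //; exact: le_ball le2 _ xy.
have {}ce1 x : P.1 x -> forall l, size l = q.+2 ->
    all_in (ball x eps `&` P.1) l -> delta c l = 0.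
  move=> Px l ln xl; apply: (ce1 x) => //; apply: all_in_sub xl => y [xy ?].
  by split=> //; exact: le_ball le1 _ xy.
have half0 : 0 < eps / 2 by rewrite divr_gt0.
have pP1 := @push_P1 _ _ _ P21 eps.
pose r := push P (eps / 2).
have loc x : (P.2 `|` C) x -> exists2 U, nbhs x U & forall l, size l = q.+1 ->
    all_in U l -> push_ext P eps c l = 0 by exact: push_ext_loc_zero.
exists (push_ext P eps c); first split.
- move=> x /loc [U xU hU]; exists U => // l ln Ul; apply: hU => //.
  by apply: all_in_sub Ul => y [].
- move=> x PCx; have [Cx|nCx] := pselect (C x).
    have [U xU hU] := loc x (or_intror Cx); exists U => // l ln Ul.
    apply: delta_vanish Ul => u; rewrite ln => -[] un Uu; apply: hU => //.
    by apply: all_in_sub Uu => y [].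
  have Px : P.1 x by case: PCx.
  exists (ball x (eps / 2) `&` ~` C).
    apply: filterI; first exact: nbhsx_ballx.
    by apply: open_nbhs_nbhs; split=> //; exact: closed_openC.
  move=> l ln xl; have {}xl : all_in (ball x (eps / 2) `&` P.1) l.
    by apply: all_in_sub xl => y [[? ?] []].
  rewrite push_ext_delta; last by apply: all_in_sub xl => y [].
  by apply: (ce1 x) => //; [rewrite size_map|exact: all_in_push xl].
exists (fun l => - prism r c l); first split.
- apply: loc_zeroN => x Px; exists (ball x (eps / 2)); first exact: nbhsx_ballx.
  move=> l ln xl; apply: (@prism_vanish _ _ (ball x eps `&` P.2)).
  + by move=> u un; apply: ce2 => //; rewrite un ln.
  + exact: all_in_half xl.
  + by apply: (all_in_push eps0) xl => y; exact: push_P2.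
- by move=> _; rewrite oppr0.
- move=> x Px; exists (ball x (eps / 2)); first exact: nbhsx_ballx.
  move=> l ln xl; have Pl : all_in P.1 l by apply: all_in_sub xl => y [].
  rewrite push_ext_in //.
  have -> : delta (fun u => - prism r c u) l = - delta (prism r c) l.
    rewrite -mulN1r -deltaZ; apply: delta_ext => u _; by rewrite mulN1r.
  have p0 : prism r (delta c) l = 0.
    apply: (@prism_vanish _ _ (ball x eps `&` P.1)).
    + by move=> u un; apply: ce1 => //; rewrite un ln.
    + exact: all_in_half xl.
    + by apply: (all_in_push eps0) xl => y; exact: pP1.
  by have := prismP r c l; rewrite p0 addr0 => ->; rewrite /r; ring.
Qed.

(** A primitive on [P] is extended by [push_ext]; the prism operator corrects
    for the difference between the cocycle and its pullback by [push]. *)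
Lemma excision_inj q d : rel_cocycle (addC P C) q.+1 d -> rel_coboundary P q.+1 d ->
  rel_coboundary (addC P C) q.+1 d.
Proof.
move=> [d2 d1] [e [e2 e0] e1].
have sub1 : P.1 `<=` P.1 `|` C by move=> x; left.
have sub2 : P.2 `<=` P.2 `|` C by move=> x; left.
have [x1 x10 h1] := loc_zero_uniform cP2 sub2 d2.
have [x2 x20 h2] := loc_zero_uniform cP1 sub1 d1.
have [x3 x30 h3] := loc_zero_uniform cP2 (@subset_refl _ _) e2.
have [x4 x40 h4] := loc_zero_uniform cP1 (@subset_refl _ _) e1.
pose eps := Order.min (Order.min x1 x2) (Order.min x3 x4).
have eps0 : 0 < eps by rewrite !lt_min x10 x20 x30.
have le1 : eps <= x1 by rewrite !ge_min lexx.
have le2 : eps <= x2 by rewrite !ge_min lexx orbT.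
have le3 : eps <= x3 by rewrite !ge_min lexx !orbT.
have le4 : eps <= x4 by rewrite !ge_min lexx !orbT.
have shrink (x : X) (A : set X) a l : eps <= a -> all_in (ball x eps `&` A) l ->
  all_in (ball x a `&` A) l.
  by move=> la; apply: all_in_sub => y [xy ?]; split=> //; exact: le_ball la _ xy.
have half0 : 0 < eps / 2 by rewrite divr_gt0.
pose r := push P (eps / 2).
have rP1 x : (P.1 `|` C) x -> (P.1 `|` C) (r x).
  case=> [Px|Cx]; first by left; exact: push_P1.
  by have [/P21|] := @push_C _ _ _ _ P21 PC _ eps0 _ Cx; [left|right].
have rP2 x : (P.2 `|` C) x -> (P.2 `|` C) (r x).
  by case=> [Px|Cx]; [left; exact: push_P2|exact: push_C].
have loc : forall x, (P.2 `|` C) x -> exists2 U, nbhs x U & forall l, size l = q ->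
    all_in U l -> push_ext P eps e l = 0.
  apply: push_ext_loc_zero => //.
  by move=> x Px l ln xl; apply: (h3 x) => //; exact: shrink xl.
have mapid (U : set X) l : U `<=` ~` P.1 -> all_in U l -> map r l = l.
  move=> UP; elim: l => //= y l IH [/UP Py Ul]; rewrite IH // /r.
  by rewrite push_id.
exists (fun l => push_ext P eps e l - prism r d l); first split.
- apply: loc_zeroB => [x /loc[U xU hU]|x PCx].
    by exists U => // l ln Ul; apply: hU => //; apply: all_in_sub Ul => y [].
  have [Px|nPx] := pselect (P.1 x).
    have {PCx} Px2 : P.2 x by case: PCx => // Cx; exact: PC.
    exists (ball x (eps / 2)); first exact: nbhsx_ballx.
    move=> l ln xl; apply: (@prism_vanish _ _ (ball x eps `&` (P.2 `|` C))).
    + by move=> u un xu; apply: (h1 x) => //; [rewrite un ln|exact: shrink xu].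
    + exact: all_in_half xl.
    + exact: (all_in_push eps0) xl.
  have [U xU dU] := d2 x PCx; exists (U `&` ~` P.1).
    by apply: filterI => //; exact: nbhs_notP1.
  move=> l ln Ul; apply: (@prism_vanish _ _ (U `&` (P.2 `|` C))).
  + by move=> u un; apply: dU; rewrite un ln.
  + by apply: all_in_sub Ul => y [[]].
  + rewrite (mapid _ _ _ Ul); first by apply: all_in_sub Ul => y [[]].
    by move=> y [[]].
- by move=> q0; rewrite push_ext_in //= e0 // subr0.
suff H x : (P.1 `|` C) x -> exists2 U, nbhs x U & forall l, size l = q.+1 ->
    all_in (U `&` (P.1 `|` C)) l ->
    d (map r l) - delta (push_ext P eps e) l = 0 /\ prism r (delta d) l = 0.
  move=> x /H[U xU hU]; exists U => // l ln Ul; have [a0 b0] := hU l ln Ul.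
  by rewrite deltaB; have := prismP r d l; rewrite b0 addr0 => ->; rewrite -a0; ring.
move=> PCx; have [Px|nPx] := pselect (P.1 x).
  have pr l : size l = q.+1 -> all_in (ball x (eps / 2) `&` (P.1 `|` C)) l ->
    prism r (delta d) l = 0.
    move=> ln xl; apply: (@prism_vanish _ _ (ball x eps `&` (P.1 `|` C))).
    + by move=> u un xu; apply: (h2 x) => //; [rewrite un ln|exact: shrink xu].
    + exact: all_in_half xl.
    + exact: (all_in_push eps0) xl.
  have [Cx|nCx] := pselect (C x).
    have P2x : P.2 x by exact: PC.
    have [U xU hU] := loc x (or_introl P2x).
    exists (U `&` ball x (eps / 2)); first by apply: filterI => //; exact: nbhsx_ballx.
    move=> l ln xl; split; last by apply: pr => //; apply: all_in_sub xl => y [[]].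
    rewrite (@delta_vanish _ U); first last.
    + by apply: all_in_sub xl => y [[]].
    + by move=> u; rewrite ln => -[] un; exact: hU.
    rewrite subr0; apply: (h1 x) => //; first by rewrite size_map.
    apply: shrink le1 _; apply/all_in_map; apply: all_in_sub xl => y [[_ xy] PCy].
    split; first by have [] := push_balls P eps0 xy.
    case: PCy => [Py|Cy]; first by left; exact: push_near xy.
    exact: rP2 (or_intror Cy).
  exists (ball x (eps / 2) `&` ~` C).
    apply: filterI; first exact: nbhsx_ballx.
    by apply: open_nbhs_nbhs; split=> //; exact: closed_openC.
  move=> l ln xl; split; last by apply: pr => //; apply: all_in_sub xl => y [[]].
  have {}xl : all_in (ball x (eps / 2) `&` P.1) l by apply: all_in_sub xl =>
    y [[? ?] []].
  rewrite push_ext_delta; last by apply: all_in_sub xl => y [].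
  apply: (h4 x) => //; first by rewrite size_map.
  by apply: shrink le4 _; apply: (all_in_push eps0) xl => y; exact: push_P1.
have Cx : C x by case: PCx.
have [U xU dU] := d1 x PCx; have [V xV dV] := d2 x (or_intror Cx).
have [W xW eW] := loc x (or_intror Cx).
exists ((U `&` V `&` W) `&` ~` P.1).
  by apply: filterI; [apply: filterI => //; exact: filterI|exact: nbhs_notP1].
move=> l ln Ul; have rl := mapid _ _ _ Ul; rewrite rl; last by move=> y [[]].
split.
  rewrite (@delta_vanish _ W); first last.
  + by apply: all_in_sub Ul => y [[[]]].
  + by move=> u; rewrite ln => -[] un; exact: eW.
  by rewrite subr0; apply: dV => //; apply: all_in_sub Ul => y [[[[? ?] ?] ?] [//|?]];
    split=> //; right.
apply: (@prism_vanish _ _ (U `&` (P.1 `|` C))).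
+ by move=> u un; apply: dU; rewrite un ln.
+ by apply: all_in_sub Ul => y [[[[? ?] ?] ?] ?].
+ rewrite rl; last by move=> y [[]].
  by apply: all_in_sub Ul => y [[[[? ?] ?] ?] ?].
Qed.

Definition incl (T : topologicalType) (P Q : set T * set T)
    (h1 : P.1 `<=` Q.1) (h2 : P.2 `<=` Q.2) :
    pair_map (subset_pair P) (subset_pair Q) :=
  @restrict_pair _ _ P Q id (fun=> cvg_id) h1 h2.

Lemma excision_bij q (h1 : P.1 `<=` (addC P C).1) (h2 : P.2 `<=` (addC P C).2) :
  bijective (as_cohom_map (incl h1 h2) q).
Proof.
apply: restrict_pair_bij => //.
- by move=> x [/P21 h|h]; [exact: or_introl|exact: or_intror].
- move=> c cc; have -> : (fun l => c (map id l)) = c by apply/funext => l;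
    rewrite map_id.
  exact: excision_inj.
- move=> c /excision_surj[d dc cd]; exists d => //.
  suff -> : (fun l => c l - d (map id l)) = (fun l => c l - d l) by [].
  by apply/funext => l; rewrite map_id.
Qed.

End ExcisionBij.

(** * Acyclic compact sets *)

(** Vanishing of reduced cohomology: in the lowest degree, [delta e] is a
    constant, so the condition is that locally constant functions are
    constant. *)
Definition racyclic (Y : topologicalType) (K : set Y) : Prop :=
  forall n (c : seq Y -> int), loc_zero K n.+2 (delta c) ->
    exists e, loc_zero K n.+1 (fun l => c l - delta e l).

Lemma cochainMz (T : Type) q (c : cochain T q) (k : int) t : (c *~ k) t = c t * k.
Proof.
have nat n : (c *+ n) t = c t * n%:Z.
  elim: n => [|n IH]; first by rewrite mulr0n mulr0.
  by rewrite mulrS -[LHS]/(c t + (c *+ n) t) IH; lia.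
case: k => n; first exact: nat.
rewrite NegzE mulrNz -[LHS]/(- (c *+ n.+1) t) nat.
by rewrite mulrN.
Qed.

Lemma cochainMzB (T : Type) q (a b : cochain T q) (i j : int) t :
  (a *~ i - b *~ j) t = a t * i - b t * j.
Proof. by rewrite -!cochainMz. Qed.

(** In degree 0 the isomorphism with the integers makes the class of any locally
    constant function proportional to the class of the constant 1, and integers
    have no torsion. *)
Lemma acyclic_set_racyclic (Y : topologicalType) (K : set Y) :
  K !=set0 -> acyclic_set K -> racyclic K.
Proof.
move=> [x0 Kx0] [[f fbij] acy] n c cK.
pose P : set Y * set Y := (K, set0).
have P21 : P.2 `<=` P.1 by [].
have class m (d : seq Y -> int) : loc_zero K m.+2 (delta d) ->
    tuple_cochain m (fun l => d (map set_val l)) \in as_cocycle (subset_pair P) m.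
  by move=> dK; apply/rel_cocycle_tuple/(rel_cocycle_val P21); split=> // x [].
have zero m (d : seq Y -> int) (h : loc_zero K m.+2 (delta d)) :
    \pi_(as_cohom (subset_pair P) m) (Subgrp (class m d h)) = 0 ->
      rel_coboundary P m.+1 d.
  by move=> /as_cohom0 /= /cobounds_tuple /(rel_coboundary_val P21).
case: n c cK => [|n] c cK; last first.
  by have [e _ e1] := zero _ _ cK (acy n.+1 isT _); exists e.
have oneK : loc_zero K 2 (delta (fun=> 1)).
  by move=> x _; exists setT; [exact: filterT|case=> [|y [|z []]]].
set z := \pi_(as_cohom (subset_pair P) 0) (Subgrp (class 0%N c cK)).
set u := \pi_(as_cohom (subset_pair P) 0) (Subgrp (class 0%N (fun=> 1) oneK)).
have zu : z *~ f u = u *~ f z.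
  apply: (bij_inj fbij); rewrite !raddfMz /=.
  by rewrite !mulrzz mulrC.
have [e _ e1] : rel_coboundary P 1 (fun l => c l * f u - 1 * f z).
  have h : loc_zero K 2 (delta (fun l => c l * f u - 1 * f z)).
    have -> : (fun l : seq Y => c l * f u - 1 * f z) =
        fun l => (fun v => 0 - (- f u) * c v) l - f z * (fun=> 1) l.
      by apply/funext => l; ring.
    apply: loc_zero_ext (loc_zero_lin (f z) (loc_zero_lin (- f u) (loc_zero_0 (A :=
      K) 2) cK) oneK) => l _.
    by rewrite delta_lin (delta_lin (fun=> 0)) delta0.
  apply: (zero _ _ h); rewrite -[RHS](subrr (z *~ f u)) [in X in _ - X]zu.
  rewrite /z /u -!raddfMz -raddfB; congr (\pi_(as_cohom (subset_pair P) 0) _).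
  apply: val_inj; rewrite raddfB !raddfMz /=; apply/funext => t.
  by rewrite mulNrz cochainMzB.
have const x : K x -> c [:: x] * f u = f z + e [::].
  move=> Kx; have [U xU hU] := e1 x Kx.
  have := hU [:: x] erefl; rewrite /= => /(_ _)/eqP; rewrite subr0 mul1r => h.
  have {}h := h (conj (conj (nbhs_singleton xU) Kx) I); lia.
exists (fun=> c [:: x0]) => x Kx; exists setT; first exact: filterT.
move=> -[|y [|? ?]] //= _ [[_ Ky] _]; rewrite subr0.
have [u0|u0] := eqVneq (f u) 0; last first.
  apply/eqP; rewrite subr_eq0; apply/eqP/(mulIf u0).
  by rewrite !const.
have /zero[d [_ d0] /(_ x0 Kx0)[U xU hU]] : u = 0.
  by apply: (bij_inj fbij); rewrite u0 raddf0.
have := hU [:: x0] erefl (conj (conj (nbhs_singleton xU) Kx0) I).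
by rewrite /= d0.
Qed.

(** * Discontinuous approximations of the identity *)

Lemma filter_seq (T : Type) (I : eqType) (F : set_system T) (D : seq I)
    (A : I -> set T) :
  Filter F -> (forall i, i \in D -> F (A i)) ->
  F [set y | forall i, i \in D -> A i y].
Proof.
move=> FF; elim: D => [|j D IH] h; first by apply: filterS filterT => y _ i.
have hj := h j (mem_head _ _).
have hD : F [set y | forall i, i \in D -> A i y].
  by apply: IH => i iD; apply: h; rewrite inE iD orbT.
apply: filterS (filterI hj hD) => y [Ajy ADy] i.
by rewrite inE => /predU1P[->//|/ADy].
Qed.

Lemma compact_seq_cover (Y : topologicalType) (K : set Y) (f : Y -> set Y) :
  compact K -> (forall z, K z -> nbhs z (f z)) ->
  exists2 D : seq Y, (forall z, z \in D -> K z) &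
    forall y, K y -> exists2 z, z \in D & f z y.
Proof.
move=> /compact_near_coveringP cK hf.
pose F : set_system (seq Y) :=
  [set S | exists2 D0 : seq Y, (forall z, z \in D0 -> K z) &
  forall D : seq Y, (forall z, z \in D -> K z) -> {subset D0 <= D} -> S D].
have FF : Filter F.
  split; first by exists [::].
    move=> A B [a aK hA] [b bK hB]; exists (a ++ b).
      by move=> z; rewrite mem_cat => /orP[/aK|/bK].
    move=> D DK abD; split.
      by apply: hA => // z za; apply: abD; rewrite mem_cat za.
    by apply: hB => // z zb; apply: abD; rewrite mem_cat zb orbT.
  by move=> A B AB [a aK hA]; exists a => // D DK aD; apply/AB/hA.
have [|D0 D0K hD] := cK _ F (fun D y => exists2 z, z \in D & f z y) FF.
  move=> x Kx; exists (f x, [set D : seq Y | x \in D]) => /=.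
    split; first exact: hf.
    exists [:: x]; first by move=> z; rewrite inE => /eqP ->.
    by move=> D _ xD; apply: xD; rewrite mem_head.
  by move=> [y D] /= [fxy xD]; exists x.
by exists D0 => // y Ky; apply: hD.
Qed.

(** Regularity of the compact set [Y0]. *)
Lemma compact_closed_nbhs (Y : topologicalType) (Y0 W : set Y) (z : Y) :
  hausdorff_space Y -> compact Y0 -> nbhs z W ->
  exists B, [/\ closed B, nbhs z B & B `&` Y0 `<=` W].
Proof.
move=> hY cY0 zW.
have cK : compact (Y0 `&` ~` W°) by apply: compact_closedI => //;
  apply/open_closedC/open_interior.
have sep y : exists AB : set Y * set Y, (Y0 `&` ~` W°) y ->
    [/\ open AB.1, open AB.2, AB.1 z, AB.2 y & AB.1 `&` AB.2 = set0].
  have [Ky|nKy] := pselect ((Y0 `&` ~` W°) y); last by exists (set0, set0).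
  have zy : z != y by apply/eqP => zy; case: Ky => _; rewrite -zy.
  move: hY; rewrite open_hausdorff =>
    /(_ _ _ zy)[AB [/set_mem ? /set_mem ?] [? ? /eqP ?]].
  by exists AB.
have [f hf] := choice sep.
have [|D DK KD] := compact_seq_cover (f := fun y => (f y).2) cK.
  by move=> y /hf[]; move=> *; apply: open_nbhs_nbhs.
exists (~` [set s | exists2 y, y \in D & (f y).2 s]); split.
- apply: open_closedC; rewrite openE => s [y yD ys].
  have [_ oy _ _ _] := hf y (DK y yD).
  by apply: filterS (open_nbhs_nbhs (conj oy ys)) => t yt; exists y.
- apply: filterS (filter_seq (D := D) (A := fun y => (f y).1) _ _).
    move=> s hs [y yD ys]; have [_ _ _ _ f0] := hf y (DK y yD).
    have fs : ((f y).1 `&` (f y).2) s by split=> //; exact: hs.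
    by rewrite f0 in fs.
  by move=> y /DK /hf[? ? ? ? _]; exact: open_nbhs_nbhs.
- move=> y [nKy Y0y]; apply: interior_subset; apply: contrapT => nWy.
  by apply: nKy; exact: KD.
Qed.

(** Near a compact set [K], the identity is approximated as closely as wanted
    by a map with finitely many values, all in [K]; such a map cannot be
    continuous, but the prism operator does not mind. *)
Lemma finite_approximation (Y : topologicalType) (Y0 K : set Y) (W : Y -> set Y) :
  hausdorff_space Y -> compact Y0 -> compact K -> K `<=` Y0 ->
  (forall z, K z -> nbhs z (W z)) ->
  exists r : Y -> Y, exists O : set Y, exists ks : seq Y,
  [/\ open O, K `<=` O, (forall k, k \in ks -> K k),
      (forall y, O y -> r y \in ks) &
      forall y, O y -> exists2 V, nbhs y V & exists2 z, K z &
        forall s, V s -> O s -> Y0 s -> W z s /\ W z (r s)].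
Proof.
move=> hY cY0 cK KY0 hW.
have sep z : exists B : set Y, K z ->
    [/\ closed B, nbhs z B & B `&` Y0 `<=` W z].
  have [Kz|nKz] := pselect (K z); last by exists setT.
  by have [B hB] := compact_closed_nbhs hY cY0 (hW z Kz); exists B.
have [B hB] := choice sep.
have [|D1 D1K KD1] := compact_seq_cover (f := fun z => (B z)°) cK.
  by move=> z /hB[_ + _]; exact: nbhs_interior.
(* Points of [N k] meet only those closed sets of the cover that contain [k],
   so they share a small set with [k]. *)
pose N k := [set s | forall z, z \in D1 -> ~ B z k -> ~ B z s].
have oN k : open (N k).
  rewrite openE => s Ns; apply: filter_seq => z zD1.
  have [cB _ _] := hB z (D1K z zD1).
  have [Bk|nBk] := pselect (B z k); first by apply: nearW.
  apply: filterS (open_nbhs_nbhs (conj (closed_openC cB) (Ns z zD1 nBk))).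
  by [].
have [|D2 D2K KD2] := compact_seq_cover (f := N) cK.
  by move=> z Kz; apply: open_nbhs_nbhs; split=> // y _.
exists (fun s => xget s [set k | k \in D2 /\ N k s]).
exists ([set s | exists2 z, z \in D1 & (B z)° s] `&` [set s | exists2 k, k \in D2 &
  N k s]).
exists D2.
have rP s : (exists2 k, k \in D2 & N k s) ->
    let k := xget s [set k | k \in D2 /\ N k s] in k \in D2 /\ N k s.
  by move=> [k kD2 Nk] /=; case: xgetP => [k' _ //|/(_ k)]; case.
have oU (D : seq Y) (G : Y -> set Y) : (forall z, open (G z)) ->
    open [set s | exists2 z, z \in D & G z s].
  move=> oG; rewrite openE => s [z zD Gs].
  by apply: filterS (open_nbhs_nbhs (conj (oG z) Gs)) => t Gt; exists z.
split.
- by apply: openI; apply: oU => // z; exact: open_interior.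
- by move=> k Kk; split; [exact: KD1|exact: KD2].
- by [].
- by move=> y [_ /rP[]].
- move=> y [[z zD1 Bzy] _]; exists (B z)°.
    by apply: open_nbhs_nbhs; split=> //; exact: open_interior.
  have Kz := D1K z zD1; exists z => //.
  have [_ _ BW] := hB z Kz.
  move=> s /interior_subset Bzs [_ /rP /= [rD2 Nr]] Y0s; split; first exact: BW.
  apply: BW; split; last by apply/KY0/D2K.
  by apply: contrapT => /(Nr z zD1).
Qed.

(** * Uniform acyclicity *)

Section Uniform.
Variables (Y : topologicalType) (K : set Y).
Implicit Types (W : Y -> set Y) (c e : seq Y -> int) (G : set (seq Y -> int)).

(** A scale assigns a neighbourhood to every point of [K]; a list is small if
    one of these neighbourhoods contains it.  Scales stand in for open covers
    and need no uniform structure. *)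
Definition scale W : Prop := forall z, K z -> nbhs z (W z).

Definition vanishes W n c : Prop :=
  forall z, K z -> forall l, size l = n -> all_in (W z `&` K) l -> c l = 0.

Definition bounds W n c : Prop := exists e, vanishes W n (fun l => c l - delta e l).

Lemma scaleI W W' : scale W -> scale W' -> scale (fun z => W z `&` W' z).
Proof. by move=> h h' z Kz; apply: filterI; [exact: h|exact: h']. Qed.

Lemma vanishes_sub W W' n c : (forall z, W' z `<=` W z) -> vanishes W n c ->
  vanishes W' n c.
Proof.
move=> WW h z Kz l ln zl; apply: (h z) => //.
by apply: all_in_sub zl => y [/WW].
Qed.

Lemma vanishes_lin W n c e (k : int) : vanishes W n c -> vanishes W n e ->
  vanishes W n (fun l => c l - k * e l).
Proof. by move=> hc he z Kz l ln zl; rewrite (hc z) // (he z) // mulr0 subr0. Qed.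

Lemma vanishes_ext W n c e : (forall l, c l = e l) -> vanishes W n c -> vanishes W n e.
Proof. by move=> ce h z Kz l ln zl; rewrite -ce (h z). Qed.

Lemma bounds_lin W n c e (k : int) : bounds W n c -> bounds W n e ->
  bounds W n (fun l => c l - k * e l).
Proof.
move=> [a ha] [b hb]; exists (fun l => a l - k * b l).
apply: vanishes_ext (vanishes_lin k ha hb) => l.
by rewrite delta_lin; ring.
Qed.

Lemma bounds_sub W W' n c : (forall z, W' z `<=` W z) -> bounds W n c -> bounds W' n c.
Proof. by move=> WW [e he]; exists e; apply: vanishes_sub he. Qed.

Definition group_like G : Prop :=
  G (fun=> 0) /\ forall c e (k : int), G c -> G e -> G (fun l => c l - k * e l).

(** The values [c f] form a subgroup of the integers; [g] realizes a generator. *)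
Lemma generating_value G (f : seq Y) : group_like G ->
  exists2 g, G g & forall c, G c -> exists k, c f = k * g f.
Proof.
move=> [G0 GB].
have [h|h] := pselect (exists m : nat,
  `[< exists2 g, G g & (0 < m)%N /\ absz (g f) = m >]); last first.
  exists (fun=> 0) => // c Gc; exists 0; rewrite mul0r; apply: contrapT => /eqP cf.
  by apply: h; exists (absz (c f)); apply/asboolP; exists c => //; rewrite absz_gt0.
case: (ex_minnP h) => m /asboolP[g Gg [m0 gm]] mmin.
exists g => // c Gc; exists (c f %/ g f)%Z; apply/eqP; rewrite -subr_eq0; apply/eqP.
have gf0 : g f != 0 by rewrite -absz_gt0 gm.
have e1 : c f - (c f %/ g f)%Z * g f =
  (c f %% g f)%Z by rewrite {1}(divz_eq (c f) (g f)); ring.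
have r0 : 0 <= (c f %% g f)%Z by exact: modz_ge0.
have r1 : (c f %% g f)%Z < `|g f| by exact: ltz_mod.
rewrite e1; apply: contrapT => /eqP rn0.
have ge : (m <= absz (c f %% g f)%Z)%N.
  apply: mmin; apply/asboolP; exists (fun l => c l - (c f %/ g f)%Z * g l);
    first exact: GB.
  by rewrite e1; split=> //; rewrite absz_gt0.
have lt : (absz (c f %% g f)%Z < m)%N by rewrite -gm -ltz_nat !abszE ger0_norm.
by rewrite leqNgt lt in ge.
Qed.

(** Only finitely many evaluations have to be matched, and the values of a
    group of integer cochains under one evaluation form a cyclic group: so a
    common scale serves for the whole group. *)
Lemma common_scale n G (fs : seq (seq Y)) : group_like G ->
  (forall c, G c -> exists2 W, scale W & bounds W n c) ->
  exists2 W, scale W & forall c, G c -> exists2 c', G c' &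
    (forall f, f \in fs -> c f = c' f) /\ bounds W n c'.
Proof.
elim: fs G => [|f fs IH] G gG hG.
  have [G0 _] := gG; exists (fun=> setT); first by move=> z _; exact: filterT.
  move=> c _; exists (fun=> 0) => //; split=> //; exists (fun=> 0) => z _ l _ _.
  by rewrite delta0 subrr.
have [g Gg hg] := generating_value f gG; have [G0 GB] := gG.
have [||W1 sW1 hW1] := IH [set c | G c /\ c f = 0]; last first.
- have [W2 sW2 hW2] := hG g Gg.
  exists (fun z => W1 z `&` W2 z); first exact: scaleI.
  move=> c Gc; have [k ck] := hg c Gc.
  have [|c' [Gc' c'f] [c'fs bc']] := hW1 (fun l => c l - k * g l).
    by split; [exact: GB|rewrite ck subrr].
  exists (fun l => c' l - (- k) * g l); first exact: GB.
  split=> [u|]; last first.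
    by apply: bounds_lin; [apply: bounds_sub bc' => z y []|apply: bounds_sub hW2 =>
      z y []].
  rewrite inE => /predU1P[->|/c'fs <-]; last by ring.
  by rewrite c'f ck; ring.
- by move=> c [/hG].
- split=> [|c e k [Gc cf] [Ge ef]]; first by split.
  by split; [exact: GB|rewrite cf ef mulr0 subr0].
Qed.

Fixpoint words (ks : seq Y) n : seq (seq Y) :=
  if n is m.+1 then [seq x :: w | x <- ks, w <- words ks m] else [:: [::]].

Lemma mem_words ks n (l : seq Y) : size l = n -> (forall x, x \in l -> x \in ks) ->
  l \in words ks n.
Proof.
elim: l n => [|x l IH] [|n] //= [ln] h; apply: allpairs_f; first by apply: h;
  rewrite mem_head.
by apply: IH => // y yl; apply: h; rewrite inE yl orbT.
Qed.

Lemma all_in_mem (U : set Y) (l : seq Y) : all_in U l <-> forall x, x \in l -> U x.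
Proof.
elim: l => //= x l IH; split=> [[Ux /IH Ul] y|h].
  by rewrite inE => /predU1P[->//|/Ul].
split; first by apply: h; rewrite mem_head.
by apply/IH => y yl; apply: h; rewrite inE yl orbT.
Qed.

(** Up to the prism of a finite approximation of the identity, a cocycle at the
    scale [W] is determined by its values on the words in finitely many points,
    and [common_scale] provides a primitive scale for these. *)
Lemma uniform_acyclicity n W : hausdorff_space Y -> compact K -> racyclic K ->
  scale W ->
  exists2 W', scale W' & forall c, vanishes W n.+2 (delta c) -> bounds W' n.+1 c.
Proof.
move=> hY cK acy sW.
have [r [NK [ks [oNK KO ksK rks hr]]]] :=
  finite_approximation hY cK cK (@subset_refl _ _) sW.
have gG : group_like [set c | vanishes W n.+2 (delta c)].
  split=> [z _ l _ _|c e k hc he] /=; first exact: delta0.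
  by apply: vanishes_ext (vanishes_lin k hc he) => l; rewrite delta_lin.
have [|W1 sW1 hW1] := @common_scale n.+1 _ (words ks n.+1) gG.
  move=> c hc; have [|e he] := acy n c.
    move=> x Kx; exists (W x); [exact: sW|exact: hc].
  have hU x : exists U, K x -> nbhs x U /\ forall l, size l = n.+1 ->
      all_in (U `&` K) l -> c l - delta e l = 0.
    have [Kx|nKx] := pselect (K x); last by exists setT.
    by have [U ? ?] := he x Kx; exists U.
  have [U hU'] := choice hU.
  exists U; first by move=> z /hU'[].
  by exists e => z /hU'[_ h].
have hV y : exists V, K y -> nbhs y V /\ exists2 z, K z &
    forall s, V s -> K s -> W z s /\ W z (r s).
  have [Ky|nKy] := pselect (K y); last by exists setT.
  have [V yV [z Kz hz]] := hr y (KO y Ky); exists V => _; split=> //.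
  by exists z => // s Vs Ks; apply: hz => //; exact: KO.
have [V hV'] := choice hV.
have rK s : K s -> K (r s) by move=> /KO /rks /ksK.
exists (fun z => V z `&` W1 z); first by apply: scaleI => // z /hV'[].
have close c : vanishes W n.+2 (delta c) -> forall y, K y -> forall l, size l = n.+1 ->
    all_in (V y `&` K) l -> c l = c (map r l) - delta (prism r c) l.
  move=> hc y Ky l ln yl; have [_ [z Kz hz]] := hV' y Ky.
  have p0 : prism r (delta c) l = 0.
    apply: (@prism_vanish _ _ (W z `&` K)).
    - by move=> u un; apply: hc => //; rewrite un ln.
    - by apply: all_in_sub yl => s [Vs Ks]; split=> //; have [] := hz s Vs Ks.
    - apply/all_in_map; apply: all_in_sub yl => s [Vs Ks]; split; last exact: rK.
      by have [] := hz s Vs Ks.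
  by have := prismP r c l; rewrite p0 addr0 => ->; ring.
move=> c hc; have [c' hc' [cc' [e he]]] := hW1 c hc.
exists (fun l => e l - (prism r c l - prism r c' l)) => y Ky l ln yl.
have Vl : all_in (V y `&` K) l by apply: all_in_sub yl => s [[]].
have Wl : all_in (W1 y `&` K) l by apply: all_in_sub yl => s [[]].
rewrite deltaB deltaB (close c hc y) // (cc' (map r l)); last first.
  apply: mem_words; first by rewrite size_map.
  move=> x; apply: (all_in_mem (fun x => x \in ks) _).1; apply/all_in_map.
  by apply: all_in_sub yl => s [_ Ks]; apply/rks/KO.
have := he y Ky l ln Wl; rewrite (close c' hc' y) // => /eqP; lia.
Qed.

End Uniform.

(** * Cochains near the graph of a map with acyclic fibres *)

Section GraphBicomplex.
Variables (R : realType) (X : metricType R) (Y : topologicalType) (p : Y -> X).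
Hypotheses (hY : hausdorff_space Y) (cp : continuous p)
  (pproper : forall K, compact K -> compact (p @^-1` K))
  (psurj : forall x, exists y, p y = x)
  (pacy : forall x, racyclic (p @^-1` [set x])).
Implicit Types (A : set X) (phi chi : seq X -> seq Y -> int).

(** Vanishing near the graph of [p]: the cochains with [a] vertices in [X] and
    [b] in [Y], modulo these, are the groups of a bicomplex whose edges are the
    cochain complexes of [X] ([b = 0]) and of [Y] ([a = 0]). *)
Definition graph_zero A a b phi : Prop :=
  forall y, A (p y) -> exists U, exists V, [/\ nbhs (p y) U, nbhs y V &
    forall t s, size t = a -> size s = b -> all_in (U `&` A) t ->
      all_in (V `&` p @^-1` A) s -> phi t s = 0].

Lemma graph_zero_lin A a b phi chi (k : int) : graph_zero A a b phi ->
  graph_zero A a b chi ->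
  graph_zero A a b (fun t s => phi t s - k * chi t s).
Proof.
move=> h1 h2 y Ay; have [U [V [pU yV UV]]] := h1 y Ay.
have [U' [V' [pU' yV' UV']]] := h2 y Ay.
exists (U `&` U'), (V `&` V'); split; [exact: filterI|exact: filterI|].
move=> t s ta sb tU sV; rewrite UV ?UV' ?mulr0 ?subr0 //.
- by apply: all_in_sub tU => x [[]].
- by apply: all_in_sub sV => x [[]].
- by apply: all_in_sub tU => x [[]].
- by apply: all_in_sub sV => x [[]].
Qed.

Lemma graph_zero_ext A a b phi chi :
  (forall t s, size t = a -> size s = b -> phi t s = chi t s) ->
  graph_zero A a b phi -> graph_zero A a b chi.
Proof.
move=> e h y Ay; have [U [V [pU yV UV]]] := h y Ay; exists U, V; split=> //.
by move=> t s ta sb tU sV; rewrite -e // UV.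
Qed.

Lemma graph_zeroB A a b phi chi : graph_zero A a b phi -> graph_zero A a b chi ->
  graph_zero A a b (fun t s => phi t s - chi t s).
Proof.
by move=> h1 h2; apply: graph_zero_ext (graph_zero_lin 1 h1 h2) => t s _ _;
  rewrite mul1r.
Qed.

Lemma graph_zero_0 A a b : graph_zero A a b (fun _ _ => 0).
Proof. by move=> y _; exists setT, setT; split=> //; exact: filterT. Qed.

Lemma graph_zero_sign A a b phi :
  graph_zero A a b (fun t s => (-1) ^+ size t * phi t s) <->
  graph_zero A a b phi.
Proof.
have H chi : graph_zero A a b chi ->
  graph_zero A a b (fun t s => (-1) ^+ size t * chi t s).
  move=> h y Ay; have [U [V [pU yV UV]]] := h y Ay; exists U, V; split=> //.
  by move=> t s ta sb tU sV; rewrite UV ?mulr0.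
split=> [h|]; last exact: H.
apply: graph_zero_ext (H _ h) => t s _ _.
by rewrite mulrA -exprD addnn -mul2n exprM sqrrN !expr1n mul1r.
Qed.

Lemma graph_zero_sub A B a b phi : B `<=` A -> graph_zero A a b phi ->
  graph_zero B a b phi.
Proof.
move=> BA h y By; have [U [V [pU yV UV]]] := h y (BA _ By).
exists U, V; split=> // t s ta sb tU sV; apply: UV => //.
  by apply: all_in_sub tU => x [? /BA].
by apply: all_in_sub sV => x [? /BA].
Qed.

Lemma graph_zero_delta2 A a b phi : graph_zero A a b phi ->
  graph_zero A a b.+1 (fun t s => delta (phi t) s).
Proof.
move=> h y Ay; have [U [V [pU yV UV]]] := h y Ay; exists U, V; split=> //.
move=> t s ta sb tU sV; apply: delta_vanish sV => u; rewrite sb => -[] ub Vu.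
exact: UV.
Qed.

Lemma graph_zero_delta1 A a b phi : graph_zero A a b phi ->
  graph_zero A a.+1 b (fun t s => delta (fun u => phi u s) t).
Proof.
move=> h y Ay; have [U [V [pU yV UV]]] := h y Ay; exists U, V; split=> //.
move=> t s ta sb tU sV; apply: delta_vanish tU => u; rewrite ta => -[] ua Uu.
exact: UV.
Qed.

Lemma graph_zero_edgeX A a (c : seq X -> int) : graph_zero A a 0 (fun t _ => c t) <->
  loc_zero A a c.
Proof.
split=> [h x Ax|h y Ay].
  have [y yx] := psurj x; have [|U [V [pU yV UV]]] := h y; first by rewrite yx.
  by exists U; [rewrite -yx|move=> t ta tU; exact: (UV t [::])].
have [U pU hU] := h _ Ay; exists U, setT; split=> //; first exact: filterT.
by move=> t s ta _ tU _; exact: hU.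
Qed.

Lemma graph_zero_edgeY A b (c : seq Y -> int) : graph_zero A 0 b (fun _ s => c s) <->
  loc_zero (p @^-1` A) b c.
Proof.
split=> [h y Ay|h y Ay].
  have [U [V [pU yV UV]]] := h y Ay.
  by exists V => // s sb sV; exact: (UV [::] s).
have [V yV hV] := h _ Ay; exists setT, V; split=> //; first exact: filterT.
by move=> t s _ sb _ sV; exact: hV.
Qed.

Lemma graph_zero_inj0 A a phi : graph_zero A a 1 (fun t s => delta (phi t) s) ->
  graph_zero A a 0 phi.
Proof.
move=> h y Ay; have [U [V [pU yV UV]]] := h y Ay.
exists U, V; split=> // t s ta; case: s => // _ tU _.
have := UV t [:: y] ta erefl tU (conj (conj (nbhs_singleton yV) Ay) I).
by rewrite /= subr0.
Qed.

(** The radius in [X] can be chosen independent of the point of the fibre,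
    which is compact. *)
Lemma nbhs_tube A a b phi x : A x ->
  graph_zero A a b phi -> exists2 e : R, 0 < e & forall y, p y = x -> exists2 V,
    nbhs y V &
    forall t s, size t = a -> size s = b -> all_in (ball x e `&` A) t ->
      all_in (V `&` p @^-1` A) s -> phi t s = 0.
Proof.
move=> Ax h.
have /compact_near_coveringP cK := pproper (@compact_set1 X x).
have : \forall e \near (0 : R)^'+, forall y, (p @^-1` [set x]) y -> exists2 V,
  nbhs y V &
    forall t s, size t = a -> size s = b -> all_in (ball x e `&` A) t ->
      all_in (V `&` p @^-1` A) s -> phi t s = 0.
  apply: cK => y /= yx; have [|U [V [pU yV UV]]] := h y; first by rewrite yx.
  move: pU; rewrite yx -nbhs_ballE => -[d /= d0 dU].
  exists (V°, [set e | e < d]) => /=.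
    by split; [exact: nbhs_interior|exact: nbhs_right_lt].
  move=> [z e] /= [Vz ed]; exists V => // t s ta sb tU sV; apply: UV => //.
  by apply: all_in_sub tU => w [/(le_ball (ltW ed)) /dU].
move=> H; near (0 : R)^'+ => e.
exists e; first by near: e; exact: nbhs_right_gt.
by move=> y yx; move: (y) yx; near: e.
Unshelve. all: by end_near. Qed.

(** A proper map is closed. *)
Lemma fibre_nbhs A x (N : set Y) : compact A -> open N -> p @^-1` [set x] `<=` N ->
  exists2 e : R, 0 < e & forall y, A (p y) -> ball x e (p y) -> N y.
Proof.
move=> cA oN xN.
have cK : compact (p @` (p @^-1` A `&` ~` N)).
  apply: continuous_compact; first exact: continuous_subspaceT.
  by apply: compact_closedI; [exact: pproper|exact: open_closedC].
have : nbhs x (~` (p @` (p @^-1` A `&` ~` N))).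
  apply: open_nbhs_nbhs; split.
    by apply: closed_openC; apply: compact_closed cK; exact: metric_hausdorff.
  by move=> [y [_ nNy] yx]; exact/nNy/xN.
rewrite -nbhs_ballE => -[e /= e0 he]; exists e => // y Ay xy.
by apply: contrapT => nNy; apply: (he _ xy); exists y.
Qed.

(** Tautness of the fibre over [x] carries its uniform acyclicity over to the
    preimage of a ball. *)
Lemma local_exact A a n phi x : compact A -> A x ->
  graph_zero A a n.+2 (fun t s => delta (phi t) s) ->
  exists2 e : R, 0 < e & exists chi, forall y, A (p y) -> ball x e (p y) ->
    exists2 V, nbhs y V & forall t s, size t = a -> size s = n.+1 ->
      all_in (ball x e `&` A) t -> all_in (V `&` p @^-1` A) s -> phi t s =
        delta (chi t) s.
Proof.
move=> cA Ax h; pose K := p @^-1` [set x].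
have cK : compact K by apply: pproper; exact: compact_set1.
have KA : K `<=` p @^-1` A by move=> y yx /=; rewrite yx.
have [e1 e10 he1] := nbhs_tube Ax h.
have hW y : exists W, K y -> nbhs y W /\ forall t s, size t = a -> size s = n.+2 ->
    all_in (ball x e1 `&` A) t -> all_in (W `&` p @^-1` A) s -> delta (phi t) s = 0.
  have [Ky|nKy] := pselect (K y); last by exists setT.
  by have [W yW hW] := he1 y Ky; exists W.
have [W hW'] := choice hW.
have sW : scale K W by move=> z /hW'[].
have [W' sW' hW''] := @uniform_acyclicity _ K n W hY cK (@pacy x) sW.
have hE t : exists e, size t = a -> all_in (ball x e1 `&` A) t ->
    vanishes K W' n.+1 (fun l => phi t l - delta e l).
  have [[ta tA]|nt] := pselect (size t = a /\ all_in (ball x e1 `&` A) t); last first.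
    by exists (fun=> 0) => ta tA; case: nt.
  have [|e he] := hW'' (phi t).
    move=> z Kz s sn zs; have [_ hz] := hW' z Kz; apply: hz => //.
    by apply: all_in_sub zs => y [? /KA].
  by exists e.
have [E hE'] := choice hE.
have [r [N [ks [oN KN ksK rks hr]]]] :=
  finite_approximation hY (pproper cA) cK KA (scaleI sW sW').
have [e2 e20 he2] := fibre_nbhs cA oN KN.
have min0 : 0 < Order.min e1 e2 by rewrite lt_min e10.
exists (Order.min e1 e2) => //.
exists (fun t s => E t (map r s) - prism r (phi t) s) => y Ay xy.
have Ny : N y by apply: he2 => //; apply: le_ball xy; rewrite ge_min lexx orbT.
have [V yV [z Kz hz]] := hr y Ny.
exists (V `&` N); first by apply: filterI => //; exact: open_nbhs_nbhs.
move=> t s ta sn tA sV.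
have {}tA : all_in (ball x e1 `&` A) t.
  by apply: all_in_sub tA => w [xw ?]; split=> //; apply: le_ball xw;
    rewrite ge_min lexx.
have rK w : N w -> K (r w) by move=> /rks /ksK.
have p0 : prism r (delta (phi t)) s = 0.
  apply: (@prism_vanish _ _ (W z `&` p @^-1` A)).
  - move=> u un zu; have [_ hz'] := hW' z Kz; apply: hz' => //.
    by rewrite un sn.
  - by apply: all_in_sub sV => w [[Vw Nw] Aw]; have [[]] := hz w Vw Nw Aw.
  - apply/all_in_map; apply: all_in_sub sV => w [[Vw Nw] Aw].
    by have [_ []] := hz w Vw Nw Aw; split=> //; exact/KA/rK.
have := prismP r (phi t) s; rewrite p0 addr0 deltaB delta_map => ->.
have := hE' t ta tA z Kz (map r s); rewrite size_map => /(_ sn) e.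
suff rs : all_in (W' z `&` K) (map r s) by rewrite -(subr0_eq (e rs)); ring.
apply/all_in_map; apply: all_in_sub sV => w [[Vw Nw] Aw].
by have [_ []] := hz w Vw Nw Aw; split=> //; exact: rK.
Qed.

(** The local solutions are glued by letting the first vertex in [X] select
    the solution used; cochains being arbitrary functions, nothing has to be
    checked on overlaps. *)
Lemma column_exact A a n phi : compact A ->
  graph_zero A a.+1 n.+2 (fun t s => delta (phi t) s) ->
  exists chi, graph_zero A a.+1 n.+1 (fun t s => phi t s - delta (chi t) s).
Proof.
move=> cA h.
have loc x : exists ec : R * (seq X -> seq Y -> int), A x -> 0 < ec.1 /\
    forall y, A (p y) -> ball x ec.1 (p y) ->
    exists2 V, nbhs y V & forall t s, size t = a.+1 -> size s = n.+1 ->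
      all_in (ball x ec.1 `&` A) t -> all_in (V `&` p @^-1` A) s -> phi t s =
        delta (ec.2 t) s.
  have [Ax|nAx] := pselect (A x); last by exists (0, fun _ _ => 0).
  by have [e e0 [chi hchi]] := local_exact cA Ax h; exists (e, chi).
have [ec hec] := choice loc; pose e x := (ec x).1.
have [|D DA AD] := compact_seq_cover (f := fun x => ball x (e x / 2)) cA.
  by move=> x /hec[e0 _]; apply: nbhsx_ballx; rewrite divr_gt0.
(* The halved radii leave room for the other vertices of a small list to lie in
   the ball selected by its first vertex. *)
pose g x0 := xget x0 [set x | x \in D /\ ball x (e x / 2) x0].
have gP x0 : A x0 -> g x0 \in D /\ ball (g x0) (e (g x0) / 2) x0.
  move=> /AD[x xD xx0]; rewrite /g; case: xgetP => [y _ //|/(_ x)]; case.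
  by split.
exists (fun t => if t is x0 :: _ then (ec (g x0)).2 t else fun=> 0).
move=> y Ay; set x := p y.
have [d d0 dD] : exists2 d : R, 0 < d & forall i, i \in D -> d < e i / 4.
  have : \forall d \near (0 : R)^'+, forall i, i \in D -> d < e i / 4.
    apply: filter_seq => i /DA /hec[ei _].
    by apply: nbhs_right_lt; rewrite divr_gt0.
  move=> H; near (0 : R)^'+ => d; exists d; last by near: d.
  by near: d; exact: nbhs_right_gt.
have hV i : exists V : set Y, nbhs y V /\ (i \in D -> ball i (e i) x ->
    forall t s, size t = a.+1 -> size s = n.+1 ->
      all_in (ball i (e i) `&` A) t -> all_in (V `&` p @^-1` A) s -> phi t s =
        delta ((ec i).2 t) s).
  have [[iD ix]|ni] := pselect (i \in D /\ ball i (e i) x); last first.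
    by exists setT; split=> [|iD ix]; [exact: filterT|case: ni].
  have [_ hi] := hec i (DA i iD).
  by have [V yV hV] := hi y Ay ix; exists V.
have [V hV'] := choice hV.
exists (ball x d), [set s | forall i, i \in D -> V i s]; split.
- exact: nbhsx_ballx.
- by apply: filter_seq => i _; have [] := hV' i.
- case=> [//|x0 t] s ta sn tA sV.
  have [xx0 Ax0] : ball x d x0 /\ A x0 by have [[]] := tA.
  have [iD ix0] := gP x0 Ax0; set i := g x0 in iD ix0 *.
  have dei : d < e i / 4 := dD i iD.
  have near_i z : ball x d z -> ball i (e i) z.
    move=> xz; have : e i / 2 + (d + d) <= e i by lra.
    move=> le; apply: (le_ball le); apply: ball_triangle ix0 _.
    by apply: ball_triangle xz; exact: ball_sym.
  have [_ hi] := hV' i.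
  have ix : ball i (e i) x by apply: near_i; exact: ballxx.
  rewrite (hi iD ix (x0 :: t) s ta sn) ?subrr //.
    by apply: all_in_sub tA => z [/near_i].
  by apply: all_in_sub sV => z [/(_ i iD)].
Unshelve. all: by end_near. Qed.

End GraphBicomplex.

(** * The Vietoris-Begle theorem for compact pairs *)

Section VietorisBegle.
Variables (R : realType) (X : metricType R) (Y : topologicalType) (p : Y -> X).
Hypotheses (hY : hausdorff_space Y) (cp : continuous p)
  (pproper : forall K, compact K -> compact (p @^-1` K))
  (psurj : forall x, exists y, p y = x)
  (pacy : forall x, racyclic (p @^-1` [set x])).
Implicit Types (A : set X) (phi chi : seq X -> seq Y -> int).

(** Prepending the image of the first vertex in [Y] contracts the rows. *)
Lemma row_exact A a b phi :
  graph_zero p A a.+1 b.+1 (fun t s => delta (fun u => phi u s) t) ->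
  graph_zero p A a b.+1 (fun t s => phi t s -
    delta (fun u => if s is y :: _ then phi (p y :: u) s else 0) t).
Proof.
move=> h y Ay; have [U [V [pU yV UV]]] := h y Ay.
exists U, (V `&` p @^-1` U); split=> //; first by apply: filterI => //; exact: cp.
move=> t [|y0 s] // ta sb tU sV.
have := UV (p y0 :: t) (y0 :: s); rewrite /= ta => /(_ erefl sb) <- //.
  by split=> //; case: sV => [[[_ ?] ?] _].
by apply: all_in_sub (sV : all_in _ (y0 :: s)) => z [[]].
Qed.

Lemma row_homotopy_graph_zero A a b phi : graph_zero p A a.+1 b.+1 phi ->
  graph_zero p A a b.+1 (fun t s => if s is y :: _ then phi (p y :: t) s else 0).
Proof.
move=> h y Ay; have [U [V [pU yV UV]]] := h y Ay.
exists U, (V `&` p @^-1` U); split=> //; first by apply: filterI => //; exact: cp.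
move=> t [|y0 s] // ta sb tU sV; apply: UV => //=; first by rewrite ta.
  by split=> //; case: sV => [[[_ ?] ?] _].
by apply: all_in_sub (sV : all_in _ (y0 :: s)) => z [[]].
Qed.

Definition dhor phi : seq X -> seq Y -> int := fun t s => delta (fun u => phi u s) t.
(** The sign makes the two differentials anticommute. *)
Definition dver phi : seq X -> seq Y -> int := fun t s =>
  (-1) ^+ size t * delta (phi t) s.

Lemma dhorB phi chi : dhor (phi - chi) = dhor phi - dhor chi.
Proof. by apply/funext => t; apply/funext => s; exact: deltaB. Qed.

Lemma dverB phi chi : dver (phi - chi) = dver phi - dver chi.
Proof.
apply/funext => t; apply/funext => s; rewrite /dver.
rewrite -[RHS]/((-1) ^+ size t * delta (phi t) s - (-1) ^+ size t * delta (chi t) s).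
by rewrite -mulrBr -deltaB.
Qed.

Lemma delta_swap phi t s : delta (fun u => delta (phi u) s) t =
  delta (fun v => delta (fun u => phi u v) t) s.
Proof.
elim: s phi => [|y s IH] phi /=; first exact: delta0.
by rewrite deltaB (IH (fun u v => phi u (y :: v))).
Qed.

Lemma dhor_dver phi : dhor (dver phi) = - dver (dhor phi).
Proof.
apply/funext => t; apply/funext => s; rewrite /dhor /dver.
rewrite -[RHS]/(- ((-1) ^+ size t * delta (fun v => delta (fun u => phi u v) t) s)).
case: t => [|x t]; first by rewrite /= delta0 mulr0 oppr0.
rewrite -delta_swap exprS mulN1r mulNr opprK -deltaZ; apply: delta_ext => u /= [->].
by [].
Qed.

Lemma dver_dhor phi : dver (dhor phi) = - dhor (dver phi).
Proof. by rewrite dhor_dver opprK. Qed.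

Lemma dhor_dhor phi : dhor (dhor phi) = 0.
Proof. by apply/funext => t; apply/funext => s; exact: delta_delta. Qed.

Lemma dver_dver phi : dver (dver phi) = 0.
Proof.
apply/funext => t; apply/funext => s; rewrite /dver deltaZ.
by rewrite (_ : delta (fun u => delta (phi t) u) s = 0) ?mulr0 //; exact: delta_delta.
Qed.

Section Pair.
Variable P : set X * set X.
Hypotheses (cP1 : compact P.1) (cP2 : compact P.2) (P21 : P.2 `<=` P.1).

Let Z1 a b phi := graph_zero p P.1 a b phi.
Let Z2 a b phi := graph_zero p P.2 a b phi /\ ((a + b = 0)%N -> phi [::] [::] = 0).

Let Z1B a b phi chi : Z1 a b phi -> Z1 a b chi -> Z1 a b (phi - chi).
Proof. exact: graph_zeroB. Qed.

Let Z2B a b phi chi : Z2 a b phi -> Z2 a b chi -> Z2 a b (phi - chi).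
Proof.
move=> [h1 e1] [h2 e2]; split; first exact: graph_zeroB.
by move=> ab; rewrite -[LHS]/(phi [::] [::] - chi [::] [::]) e1 // e2.
Qed.

Let Z1h a b phi : Z1 a b phi -> Z1 a.+1 b (dhor phi).
Proof. exact: graph_zero_delta1. Qed.

Let Z1v a b phi : Z1 a b phi -> Z1 a b.+1 (dver phi).
Proof. by move=> h; apply/graph_zero_sign; exact: graph_zero_delta2. Qed.

Let Z2h a b phi : Z2 a b phi -> Z2 a.+1 b (dhor phi).
Proof. by move=> [h _]; split=> //; exact: graph_zero_delta1. Qed.

Let Z2v a b phi : Z2 a b phi -> Z2 a b.+1 (dver phi).
Proof.
by move=> [h _]; split; [apply/graph_zero_sign; exact: graph_zero_delta2|rewrite addnS].
Qed.

Let col0 a phi : Z1 a.+1 1 (dver phi) -> Z1 a.+1 0 phi.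
Proof. by move=> /graph_zero_sign; exact: graph_zero_inj0. Qed.

Let colS a b phi : Z2 a.+1 b.+1 phi -> Z1 a.+1 b.+2 (dver phi) ->
  exists2 chi, Z2 a.+1 b chi & Z1 a.+1 b.+1 (phi - dver chi).
Proof.
move=> [h2 _] /graph_zero_sign h1.
have [chi hchi] := column_exact hY cp pproper pacy cP1 h1.
have d2 : graph_zero p P.2 a.+1 b.+1 (fun t s => delta (chi t) s).
  apply: graph_zero_ext (graph_zeroB h2 (graph_zero_sub P21 hchi)) => t s _ _; ring.
have [w [w2 w1]] : exists w, graph_zero p P.2 a.+1 b w /\
    graph_zero p P.1 a.+1 b.+1 (fun t s => phi t s - delta (w t) s).
  case: b h2 h1 hchi d2 => [|b] h2 h1 hchi d2.
    by exists chi; split=> //; apply: graph_zero_inj0.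
  (* On [P.2] the solution is itself a cocycle; subtracting the coboundary of its
     primitive there makes it relative. *)
  have [om hom] := column_exact hY cp pproper pacy cP2 d2.
  exists (fun t s => chi t s - delta (om t) s); split=> //.
  apply: graph_zero_ext hchi => t s _ _; rewrite deltaB.
  by rewrite (_ : delta (fun u => delta (om t) u) s = 0) ?subr0 //; exact: delta_delta.
exists (fun t s => (-1) ^+ size t * w t s); first by split=> //; apply/graph_zero_sign.
apply: graph_zero_ext w1 => t s _ _.
rewrite -[RHS]/(phi t s - (-1) ^+ size t * delta (fun u =>
  (-1) ^+ size t * w t u) s) deltaZ.
by rewrite mulrA -exprD addnn -mul2n exprM sqrrN !expr1n mul1r.
Qed.

Let row0 a phi : Z1 1 a.+1 (dhor phi) -> Z1 0 a.+1 phi.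
Proof.
move=> /row_exact; apply: graph_zero_ext => -[|//] s _ _ /=.
by rewrite subr0.
Qed.

Let rowS a b phi : Z2 b.+1 a.+1 phi -> Z1 b.+2 a.+1 (dhor phi) ->
  exists2 chi, Z2 b a.+1 chi & Z1 b.+1 a.+1 (phi - dhor chi).
Proof.
move=> [h2 _] h1; exists (fun t s => if s is y :: _ then phi (p y :: t) s else 0).
  by split; [exact: row_homotopy_graph_zero|rewrite addnS].
exact: row_exact h1.
Qed.

Let zz := zigzag dhor dver Z1 Z2.

(** Evaluating [c] on a list in [X] followed by the image of a list in [Y] gives
    a zigzag from the pullback of [c] to [c]: the two differentials of
    consecutive terms add up to the coboundary of [c]. *)
Lemma zigzag_concat n c : (0 < n)%N -> rel_cocycle P n c ->
  zz n (fun=> fun t s => c (t ++ map p s)).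
Proof.
have near A m d : loc_zero A m d -> forall y, A (p y) -> exists U, exists V,
    [/\ nbhs (p y) U, nbhs y V & forall t s, (size t + size s = m)%N ->
      all_in (U `&` A) t ->
      all_in (V `&` p @^-1` A) s -> d (t ++ map p s) = 0].
  move=> hd y Ay; have [U pU hU] := hd _ Ay; exists U, (p @^-1` U); split=> //.
    exact: cp.
  move=> t s m_eq tU sU; apply: hU; first by rewrite size_cat size_map.
  by apply: all_in_cat => //; exact/all_in_map.
move=> n0 [c2 c1]; split=> k kn.
  split; last by rewrite subnKC // => n00; rewrite n00 in n0.
  move=> y Ay; have [U [V [pU yV UV]]] := near _ _ _ c2 y Ay; exists U, V; split=> //.
  by move=> t s ta sb tU sV; apply: UV => //; rewrite ta sb subnKC.
move=> y Ay; have [U [V [pU yV UV]]] := near _ _ _ c1 y Ay; exists U, V; split=> //.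
move=> t s ta sb tU sV; rewrite -(UV t s) //;
  last by rewrite ta sb addSn subnKC // ltnW.
rewrite delta_cat -(delta_map p (fun v => c (t ++ v))).
by [].
Qed.

Let zz_rev n eta : zz n eta ->
  zigzag dver dhor (fun a b => Z1 b a) (fun a b => Z2 b a) n (fun k => eta (n - k)%N).
Proof.
move=> [h2 h1]; split=> k kn.
  by have := h2 (n - k)%N (leq_subr _ _); rewrite subKn.
have := h1 (n - k.+1)%N; rewrite (_ : (n - k.+1).+1 = (n - k)%N); last by lia.
rewrite (_ : (n - (n - k.+1) = k.+1)%N); last by lia.
by move=> /(_ _); rewrite addrC; apply; lia.
Qed.

Let zzB n eta eta' : zz n eta -> zz n eta' -> zz n (fun k => eta k - eta' k).
Proof.
move=> [h2 h1] [h2' h1']; split=> k kn; first by apply: Z2B; [exact: h2|exact: h2'].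
rewrite dhorB dverB addrACA -opprD.
by apply: Z1B; [exact: h1|exact: h1'].
Qed.

(** A zigzag starting at [c] ends in a cocycle [d] of [X].  Its difference with
    the zigzag of concatenations of [d] ends in 0, and exactness of the rows
    carries this back to a primitive of the difference of [c] and the pullback
    of [d]. *)
Lemma vietoris_begle_surj q c : rel_cocycle (p @^-1` P.1, p @^-1` P.2) q.+1 c ->
  exists2 d, rel_cocycle P q.+1 d &
    rel_coboundary (p @^-1` P.1, p @^-1` P.2) q.+1 (fun l => c l - d (map p l)).
Proof.
move=> [c2 c1].
have [|||eta [e2 e1] [e0 en]] := @zigzag_exists _ dhor dver Z1 Z2 dhorB dverB dhor_dver
  dhor_dhor Z1B Z2B Z1h Z2h col0 colS q.+1 (fun _ s => c s).
- by [].
- by split=> //; apply/graph_zero_edgeY.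
- apply: graph_zero_ext ((@graph_zero_edgeY _ _ _ p P.1 q.+2 (delta c)).2 c1) =>
    -[|//] s _ _.
  by rewrite /dver /= mul1r.
pose d t := eta q.+1 t [::].
have dP : rel_cocycle P q.+1 d.
  split.
    have [h _] := e2 q.+1 (leqnn _); rewrite subnn in h.
    by apply/(graph_zero_edgeX psurj); apply: graph_zero_ext h => t [|//].
  by apply/(graph_zero_edgeX psurj); apply: graph_zero_ext en => t [|//].
exists d => //.
have z1 := zz_rev (zzB (conj e2 e1) (zigzag_concat (ltn0Sn q) dP)).
have [||xi [x2 x0] x1] := @zigzag_bounds _ dver dhor (fun a b => Z1 b a) (fun a b =>
  Z2 b a)
  dverB dhorB dver_dhor dver_dver (fun a b => @Z1B b a) (fun a b => @Z2B b a)
  (fun a b => @Z1v b a) (fun a b => @Z2v b a) row0 rowS q _ (fun _ _ => 0) z1.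
- by split=> //; exact: graph_zero_0.
- apply: (@graph_zero_ext _ _ _ p P.1 q.+1 0 (fun _ _ => 0)); last exact: graph_zero_0.
  move=> t [|//] _ _; rewrite subn0.
  rewrite -[RHS]/(eta q.+1 t [::] - d (t ++ [::]) - dhor (fun _ _ => 0) t [::]).
  by rewrite cats0 /dhor delta0 subrr subr0.
exists (xi [::]); first split.
- by apply/graph_zero_edgeY; apply: graph_zero_ext x2 => -[|//].
- exact: x0.
- apply/graph_zero_edgeY; apply: graph_zero_ext x1 => -[|//] s _ _.
  rewrite subnn e0 -[LHS]/(c s - d (map p s) - dver xi [::] s).
  by rewrite /dver mul1r.
Qed.

(** Exactness of the columns carries a primitive of the pullback of [d] along
    the zigzag of concatenations to a primitive of [d]. *)
Lemma vietoris_begle_inj q d : rel_cocycle P q.+1 d ->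
  rel_coboundary (p @^-1` P.1, p @^-1` P.2) q.+1 (fun l => d (map p l)) ->
    rel_coboundary P q.+1 d.
Proof.
move=> dP [e [e2 e0] e1].
have [||xi [x2 x0] x1] := @zigzag_bounds _ dhor dver Z1 Z2 dhorB dverB dhor_dver
  dhor_dhor Z1B Z2B Z1h Z2h col0 colS q _ (fun _ s =>
    e s) (zigzag_concat (ltn0Sn q) dP).
- by split=> //; apply/graph_zero_edgeY.
- apply: graph_zero_ext ((@graph_zero_edgeY _ _ _ p P.1 q.+1 _).2 e1) => -[|//] s _ _.
  rewrite -[RHS]/(d (map p s) - dver (fun _ s => e s) [::] s).
  by rewrite /dver mul1r.
exists (fun t => xi t [::]); first split.
- by apply/(graph_zero_edgeX psurj); apply: graph_zero_ext x2 => t [|//].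
- by move=> q0; apply: x0; rewrite addn0.
- apply/(graph_zero_edgeX psurj); apply: graph_zero_ext x1 => t [|//] _ _.
  rewrite -[LHS]/(d (t ++ [::]) - dhor xi t [::]) cats0.
  by [].
Qed.

End Pair.
End VietorisBegle.

Lemma restrict_p_bij (R : realType) (X : metricType R) (m : gmorphism X)
    (P : set X * set X) q : compact P.1 -> compact P.2 -> P.2 `<=` P.1 ->
  bijective (as_cohom_map (restrict_p m P) q).
Proof.
move=> cP1 cP2 P21; have [cp pp ps pa] := gm_vietoris m.
have hY := @gm_hausdorff _ m.
have acy x : racyclic (gm_p m @^-1` [set x]).
  apply: acyclic_set_racyclic; last exact: pa.
  by have [g gx] := ps x; exists g.
apply: restrict_pair_bij => //.
- by move=> y; exact: P21.
- by move=> c; apply: vietoris_begle_inj.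
- by move=> c; apply: vietoris_begle_surj.
Qed.

(** * The Leray functor on linked endomorphisms *)

Section LerayMap.
Variables (H K : zmodType) (phi : {additive H -> H}) (psi : {additive K -> K}).
Variables (f : {additive H -> K}) (fC : forall x, f (phi x) = psi (f x)).

Lemma iter_comm n x : f (iter n phi x) = iter n psi (f x).
Proof. by elim: n => //= n <-. Qed.

Lemma gker_map x : x \in gker phi -> f x \in gker psi.
Proof.
move=> /set_predP[n n0 xn]; apply/set_predP; exists n => //.
by rewrite -iter_comm xn raddf0.
Qed.

Definition leray_quot_fun : {additive leray_quot phi -> leray_quot psi} :=
  quot_map gker_map.

Lemma leray_quot_funC x :
  leray_quot_fun (leray_quot_map phi x) = leray_quot_map psi (leray_quot_fun x).
Proof.
rewrite -[x]reprK [leray_quot_map phi _]quot_map_pi [leray_quot_fun _]quot_map_pi.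
rewrite [in RHS](_ : leray_quot_fun _ = \pi_(leray_quot psi) (f (repr x))); last exact:
  quot_map_pi.
by rewrite [RHS]quot_map_pi fC.
Qed.

Lemma grange_map x : x \in @grange _ phi -> leray_quot_fun x \in @grange _ psi.
Proof.
move=> /set_predP hx; apply/set_predP => n n0; have [y <-] := hx n n0.
exists (leray_quot_fun y); elim: n {n0} => //= n ->.
by rewrite leray_quot_funC.
Qed.

Definition leray_fun : {additive leray_mod phi -> leray_mod psi} :=
  subgrp_map grange_map.

Lemma leray_funC x : leray_fun (leray_endo phi x) = leray_endo psi (leray_fun x).
Proof. by apply: val_inj; exact: leray_quot_funC. Qed.

End LerayMap.

Lemma leray_fun_comp (H K : zmodType) (phi : {additive H -> H}) (psi :
  {additive K -> K})
    (f : {additive H -> K}) (g : {additive K -> H})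
    (fC : forall x, f (phi x) = psi (f x)) (gC : forall y, g (psi y) = phi (g y)) :
  (forall x, g (f x) = phi x) -> forall x, leray_fun gC (leray_fun fC x) =
    leray_endo phi x.
Proof.
move=> gf x; apply: val_inj => /=; rewrite -[val x]reprK.
rewrite [X in leray_quot_fun gC X](_ : _ = \pi_(leray_quot psi) (f (repr (val x))));
  last exact: quot_map_pi.
by rewrite [LHS]quot_map_pi gf [RHS]quot_map_pi.
Qed.

(** Both composites of the induced maps are the automorphisms of the Leray
    reductions, so the induced maps are bijective. *)
Lemma leray_linked (A B : gmod_endo) (f : forall q, {additive gmod A q -> gmod B q})
    (g : forall q, {additive gmod B q -> gmod A q}) :
  (forall q x, g q (f q x) = gendo x) -> (forall q y, f q (g q y) = gendo y) ->
  gmod_iso (leray A) (leray B).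
Proof.
move=> gf fg.
have fC q x : f q (gendo x) = gendo (f q x) by rewrite -gf fg.
have gC q y : g q (gendo y) = gendo (g q y) by rewrite -fg gf.
exists (fun q => leray_fun (fC q)) => q; split; last exact: leray_funC.
have [h hK Kh] := leray_endo_bij (@gendo A q); have [k kK Kk] :=
  leray_endo_bij (@gendo B q).
have e1 := leray_fun_comp (fC q) (gC q) (gf q).
have e2 := leray_fun_comp (gC q) (fC q) (fg q).
have inj : injective (leray_fun (fC q)).
  by move=> x y xy; apply: (can_inj hK); rewrite -!e1 xy.
exists (fun y => leray_fun (gC q) (k y)) => [x|y]; last by rewrite e2 Kk.
by apply: inj; rewrite e2 Kk.
Qed.

Lemma gmod_iso_sym A B : gmod_iso A B -> gmod_iso B A.
Proof.
move=> [f hf]; exists (fun q => additive_inv (f q)) => q.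
have [bf fC] := hf q; have fK := additive_invK bf; split.
  exists (f q) => // x; apply: (bij_inj bf); by rewrite fK.
by move=> y; apply: (bij_inj bf); rewrite fC !fK.
Qed.

Lemma gmod_iso_trans A B C : gmod_iso A B -> gmod_iso B C -> gmod_iso A C.
Proof.
move=> [f hf] [g hg]; exists (fun q => zmod_comp (g q) (f q)) => q.
have [bf fC] := hf q; have [bg gC] := hg q; split; first exact: bij_comp.
by move=> x; rewrite /= fC gC.
Qed.

(** * Index maps with an arbitrary exit set *)

Section Link.
Variables (R : realType) (X : metricType R) (F : X -> set X) (m : gmorphism X).
Hypothesis Fm : determined_by F m.

Definition addC_incl (P : set X * set X) (C : set X) :
    pair_map (subset_pair P) (subset_pair (addC P C)) :=
  @restrict_pair _ _ P (addC P C) id (fun=> cvg_id) (@subsetUl _ P.1 _)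
    (@subsetUl _ P.2 _).

Section Def.
Variables (P : set X * set X) (C : set X).
Hypotheses (h1 : mimage F P.1 `<=` (addC P C).1) (h2 : mimage F P.2 `<=` (addC P C).2).

(** The index map with [C] in the role of the complement of the
    interior of the isolating neighbourhood. *)
Definition gen_index_map (q : nat) :
    {additive as_cohom (subset_pair P) q -> as_cohom (subset_pair P) q} :=
  zmod_comp (multi_cohom_map Fm h1 h2 q) (additive_inv (as_cohom_map (addC_incl P C) q)).

Definition gen_index : gmod_endo := leray (GmodEndo gen_index_map).
End Def.

Lemma additive_inv_eq (V W : zmodType) (f : {additive V -> W}) x y :
  bijective f -> f x = y -> additive_inv f y = x.
Proof. by move=> bf fx; apply: (bij_inj bf); rewrite additive_invK. Qed.

(** A single-step shift equivalence: [H^*(P) -> H^*(P')] is the restriction and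
    [H^*(P') -> H^*(P)] is induced by [F], and the two composites are the index
    maps.  Passing to the larger exit set [D] changes nothing by excision. *)
Lemma gen_index_link (P P' : set X * set X) (C C' D : set X)
    (h1 : mimage F P.1 `<=` (addC P C).1) (h2 : mimage F P.2 `<=` (addC P C).2)
    (h1' : mimage F P'.1 `<=` (addC P' C').1)
    (h2' : mimage F P'.2 `<=` (addC P' C').2) :
  compact P.1 -> compact P.2 -> P.2 `<=` P.1 ->
  compact P'.1 -> compact P'.2 -> P'.2 `<=` P'.1 ->
  closed C -> closed C' -> closed D -> C `<=` D -> C' `<=` D ->
  P'.1 `<=` P.1 -> P'.2 `<=` P.2 ->
  P.1 `&` D `<=` P.2 -> P'.1 `&` D `<=` P'.2 ->
  mimage F P.1 `<=` P'.1 `|` D -> mimage F P.2 `<=` P'.2 `|` D ->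
  gmod_iso (gen_index h1 h2) (gen_index h1' h2').
Proof.
move=> cP1 cP2 P21 cP'1 cP'2 P'21 clC clC' clD CD C'D P'P1 P'P2 PD P'D k1 k2.
have PC : P.1 `&` C `<=` P.2 by move=> x [? /CD ?]; apply: PD.
have P'C' : P'.1 `&` C' `<=` P'.2 by move=> x [? /C'D ?]; apply: P'D.
have bPC q : bijective (as_cohom_map (addC_incl P C) q) by exact: excision_bij.
have bPD q : bijective (as_cohom_map (addC_incl P D) q) by exact: excision_bij.
have bP'C' q : bijective (as_cohom_map (addC_incl P' C') q) by exact: excision_bij.
have bP'D q : bijective (as_cohom_map (addC_incl P' D) q) by exact: excision_bij.
have bp q : bijective (as_cohom_map (restrict_p m P) q) by exact: restrict_p_bij.
have bp' q : bijective (as_cohom_map (restrict_p m P') q) by exact: restrict_p_bij.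
have USl (A B B' : set X) : B `<=` B' -> A `|` B `<=` A `|` B'.
  by move=> BB x [|/BB]; [left|right].
have USr (A A' B : set X) : A `<=` A' -> A `|` B `<=` A' `|` B.
  by move=> AA x [/AA|]; [left|right].
(* Everything is compared in the pairs enlarged by [D]. *)
pose k := incl (USl P.1 _ _ CD : (addC P C).1 `<=` (addC P D).1) (USl P.2 _ _ CD).
pose k' := incl (USl P'.1 _ _ C'D :
  (addC P' C').1 `<=` (addC P' D).1) (USl P'.2 _ _ C'D).
pose l := incl (USr _ _ D P'P1 : (addC P' D).1 `<=` (addC P D).1) (USr _ _ D P'P2).
pose j := incl P'P1 P'P2.
have pj1 : (gm_preimage m P').1 `<=` (gm_preimage m P).1 by move=> x; exact: P'P1.
have pj2 : (gm_preimage m P').2 `<=` (gm_preimage m P).2 by move=> x; exact: P'P2.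
pose jG := incl pj1 pj2.
have kD1 : mimage F P.1 `<=` (addC P D).1 by move=> x /k1; apply: (USr _ _ _ P'P1).
have kD2 : mimage F P.2 `<=` (addC P D).2 by move=> x /k2; apply: (USr _ _ _ P'P2).
have kD1' : mimage F P'.1 `<=` (addC P' D).1 by move=> x /h1'; apply: (USl _ _ _ C'D).
have kD2' : mimage F P'.2 `<=` (addC P' D).2 by move=> x /h2'; apply: (USl _ _ _ C'D).
have comp (A B C0 : toppair) (f : pair_map A B) (g : pair_map B C0)
    (h : pair_map A C0) q y : (forall z, h z = g (f z)) ->
    as_cohom_map f q (as_cohom_map g q y) = as_cohom_map h q y.
  by move=> hgf; rewrite (as_cohom_map_comp (f := f) (g := g)).
apply: (@leray_linked (GmodEndo (gen_index_map h1 h2)) (GmodEndo (gen_index_map h1' h2'))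
  (fun q => as_cohom_map j q)
  (fun q => zmod_comp (multi_cohom_map Fm (k1 : mimage F P.1 `<=` (addC P' D).1) k2 q)
    (additive_inv (as_cohom_map (addC_incl P' D) q)))) => q x /=.
- have [y yx] : exists y, as_cohom_map (addC_incl P D) q y = x.
    by exists (additive_inv (as_cohom_map (addC_incl P D) q) x); rewrite additive_invK.
  have e1 : additive_inv (as_cohom_map (addC_incl P' D) q) (as_cohom_map j q x) =
    as_cohom_map l q y.
    apply: additive_inv_eq => //; rewrite -yx.
    rewrite (comp _ _ _ _ _ (incl (subset_trans P'P1 (@subsetUl _ P.1 D) :
      P'.1 `<=` (addC P D).1)
      (subset_trans P'P2 (@subsetUl _ P.2 D)))); last by move=> z; exact: val_inj.
    by apply/esym; apply: comp => z; exact: val_inj.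
  have e2 : additive_inv (as_cohom_map (addC_incl P C) q) x = as_cohom_map k q y.
    by apply: additive_inv_eq => //; rewrite -yx; apply: comp => z; exact: val_inj.
  rewrite e1 e2; congr (additive_inv _ _).
  transitivity (as_cohom_map (restrict_q Fm kD1 kD2) q y).
    by apply: comp => z; exact: val_inj.
  by apply/esym; apply: comp => z; exact: val_inj.
- have [y yx] : exists y, as_cohom_map (addC_incl P' D) q y = x.
    by exists (additive_inv (as_cohom_map (addC_incl P' D) q) x); rewrite additive_invK.
  have e1 : additive_inv (as_cohom_map (addC_incl P' D) q) x = y by exact:
    additive_inv_eq.
  have e2 : additive_inv (as_cohom_map (addC_incl P' C') q) x = as_cohom_map k' q y.
    by apply: additive_inv_eq => //; rewrite -yx; apply: comp => z; exact: val_inj.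
  rewrite e1 e2; set v := as_cohom_map (restrict_q Fm _ _) q y.
  apply/esym; apply: additive_inv_eq => //.
  rewrite [RHS](_ : _ = as_cohom_map (restrict_q Fm kD1' kD2') q y); last first.
    by apply: comp => z; exact: val_inj.
  set w := additive_inv _ _.
  have wv : as_cohom_map (restrict_p m P) q w = v by rewrite /w additive_invK.
  transitivity (as_cohom_map jG q v).
    rewrite -wv; transitivity (as_cohom_map (@restrict_pair _ _ (gm_preimage m P') P (gm_p m)
        (vietoris_continuous (gm_vietoris m)) (fun z h => P'P1 _ h) (fun z h =>
          P'P2 _ h)) q w).
      by apply: comp => z; exact: val_inj.
    by apply/esym; apply: comp => z; exact: val_inj.
  by apply: comp => z; exact: val_inj.
Qed.

End Link.

(** * Orbits in isolating neighbourhoods *)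

Lemma ultra_fmap (S T : Type) (f : S -> T) (W : set_system S) :
  UltraFilter W -> UltraFilter (f @ W).
Proof.
move=> UW; split; first exact: fmap_proper_filter.
move=> G PG WG; apply/seteqP; split=> // A GA.
have [//|WnA] := in_ultra_setVsetC (f @^-1` A) UW.
have GnA : G (~` A) by apply: WG.
by have /filter_ex[x []] : G (A `&` ~` A) by exact: filterI.
Qed.

Lemma compact_ultra_cvg (S : Type) (T : topologicalType) (A : set T) (f : S -> T)
    (W : set_system S) :
  UltraFilter W -> compact A -> W (f @^-1` A) -> exists a, A a /\ (f @ W --> a).
Proof.
move=> UW; rewrite compact_ultra => cA WA.
by have [a [Aa fa]] := cA _ (ultra_fmap f UW) WA; exists a.
Qed.

Section Dynamics.
Variables (R : realType) (X : metricType R) (F : X -> set X) (m : gmorphism X).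
Hypothesis Fm : determined_by F m.
Implicit Types (N K A B G H : set X) (P Q : set X * set X).

Lemma mimageE A : mimage F A = gm_q m @` (gm_p m @^-1` A).
Proof.
apply/seteqP; split=> [y [x Ax]|y [g Ag <-]].
  by rewrite Fm => -[g gx <-]; exists g => //=; rewrite gx.
by exists (gm_p m g) => //; rewrite Fm; exists g.
Qed.

Lemma compact_mimage A : compact A -> compact (mimage F A).
Proof.
move=> cA; rewrite mimageE; apply: continuous_compact.
  by apply: continuous_subspaceT; exact: gm_continuous.
exact: (vietoris_proper (gm_vietoris m)).
Qed.

Lemma compact_mimageI A N : compact A -> compact N -> compact (mimage F A `&` N).
Proof.
move=> cA cN; apply: compact_closedI; first exact: compact_mimage.
by apply: compact_closed => //; exact: metric_hausdorff.
Qed.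

(** Recursion on the last, resp. first, point of an orbit of [n] steps in [N]
    replaces the concatenation of orbits as sequences. *)
Fixpoint backward N n x : Prop :=
  if n is k.+1 then N x /\ exists2 y, backward N k y & F y x else N x.
Fixpoint forward N n x : Prop :=
  if n is k.+1 then N x /\ exists2 y, forward N k y & F x y else N x.

Lemma backward_in N n x : backward N n x -> N x. Proof. by case: n => //= n []. Qed.
Lemma forward_in N n x : forward N n x -> N x. Proof. by case: n => //= n []. Qed.

Lemma backward_le N n k x : (k <= n)%N -> backward N n x -> backward N k x.
Proof.
elim: k n x => [|k IH] n x; first by move=> _; exact: backward_in.
by case: n => //= n kn [Nx [y /(IH _ _ kn)]]; split=> //; exists y.
Qed.

Lemma forward_le N n k x : (k <= n)%N -> forward N n x -> forward N k x.
Proof.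
elim: k n x => [|k IH] n x; first by move=> _; exact: forward_in.
by case: n => //= n kn [Nx [y /(IH _ _ kn)]]; split=> //; exists y.
Qed.

Lemma backward_sub N K n x : K `<=` N -> backward K n x -> backward N n x.
Proof.
move=> KN; elim: n x => [|n IH] x /=; first exact: KN.
by move=> [/KN ? [y /IH]]; split=> //; exists y.
Qed.

Lemma forward_sub N K n x : K `<=` N -> forward K n x -> forward N n x.
Proof.
move=> KN; elim: n x => [|n IH] x /=; first exact: KN.
by move=> [/KN ? [y /IH]]; split=> //; exists y.
Qed.

Lemma backward_orbit N n x : backward N n x -> exists s : nat -> X, [/\ s 0%N = x,
  (forall i, (i <= n)%N -> N (s i)) & (forall i, (i < n)%N -> F (s i.+1) (s i))].
Proof.
elim: n x => [|n IH] x /=; first by move=> Nx; exists (fun=> x); split=> // i.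
move=> [Nx [y /IH[s [s0 sN sF]] Fyx]].
exists (fun i => if i is j.+1 then s j else x); split=> //.
  by case=> // i; exact: sN.
by case=> [_|i]; [rewrite s0|exact: sF].
Qed.

Lemma forward_orbit N n x : forward N n x -> exists s : nat -> X, [/\ s 0%N = x,
  (forall i, (i <= n)%N -> N (s i)) & (forall i, (i < n)%N -> F (s i) (s i.+1))].
Proof.
elim: n x => [|n IH] x /=; first by move=> Nx; exists (fun=> x); split=> // i.
move=> [Nx [y /IH[s [s0 sN sF]] Fyx]].
exists (fun i => if i is j.+1 then s j else x); split=> //.
  by case=> // i; exact: sN.
by case=> [_|i]; [rewrite s0|exact: sF].
Qed.

(** Over the compact set [N] the graph of [F] is compact, being an image of the
    preimage of [N]. *)
Lemma graph_limit (W : set_system nat) N (x y : nat -> X) a b :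
  UltraFilter W -> compact N -> (x @ W --> a) -> (y @ W --> b) ->
  (\forall k \near W, N (x k) /\ F (x k) (y k)) -> F a b.
Proof.
move=> UW cN xa yb xy.
have hg k : exists g, N (x k) /\ F (x k) (y k) -> gm_p m g = x k /\ gm_q m g = y k.
  have [[Nx]|nxy] := pselect (N (x k) /\ F (x k) (y k)).
    by rewrite Fm => -[g gx gy]; exists g.
  by have [g _] := vietoris_surjective (gm_vietoris m) a; exists g => /nxy.
have [g hg'] := choice hg.
have gN : W (g @^-1` (gm_p m @^-1` N)).
  by apply: filterS xy => k hk /=; have [-> _] := hg' k hk; case: hk.
have [c [_ gc]] := compact_ultra_cvg _ (vietoris_proper (gm_vietoris m) cN) gN.
have pc : gm_p m c = a.
  apply: (@cvg_unique _ (@metric_hausdorff _ X) (x @ W)) xa.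
  have pg := cvg_comp _ _ gc (@vietoris_continuous _ _ _ (gm_vietoris m) c).
  apply: cvg_trans pg.
  by apply: near_eq_cvg; apply: filterS xy => k /hg'[].
have qc : gm_q m c = b.
  apply: (@cvg_unique _ (@metric_hausdorff _ X) (y @ W)) yb.
  have qg := cvg_comp _ _ gc (@gm_continuous _ m c).
  apply: cvg_trans qg.
  by apply: near_eq_cvg; apply: filterS xy => k /hg'[].
by rewrite Fm; exists c.
Qed.

(** A limit of longer and longer orbits in [N] is a full orbit in [N]; limits
    along an ultrafilter exist simultaneously at all times. *)
Lemma orbit_center N U : compact N -> Defs.Inv F N `<=` U° ->
  exists k, forall x, backward N k x -> forward N k x -> U x.
Proof.
move=> cN IU; apply: contrapT => nk.
have hx k : exists x, [/\ backward N k x, forward N k x & ~ U x].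
  apply: contrapT => nx; apply: nk; exists k => x bx fx.
  by apply: contrapT => nU; apply: nx; exists x.
have [x hx'] := choice hx.
have /choice[b hb] k : exists s : nat -> X, [/\ s 0%N = x k,
  (forall i, (i <= k)%N -> N (s i)) & (forall i, (i < k)%N -> F (s i.+1) (s i))].
  by apply: backward_orbit; have [] := hx' k.
have /choice[f hf] k : exists s : nat -> X, [/\ s 0%N = x k,
  (forall i, (i <= k)%N -> N (s i)) & (forall i, (i < k)%N -> F (s i) (s i.+1))].
  by apply: forward_orbit; have [] := hx' k.
have [W [UW sW]] := ultraFilterLemma (@eventually_filter).
have ev i : \forall k \near W, (i < k)%N.
  by apply: sW; exists i.+1.
have limits (s : nat -> nat -> X) : (forall k i, (i <= k)%N -> N (s k i)) ->
    forall i, exists a, N a /\ (s^~ i @ W --> a).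
  move=> sN i; have sW' : W (s^~ i @^-1` N).
    by apply: filterS (ev i) => k ik; apply: sN; exact: ltnW.
  by have [a [Na sa]] := compact_ultra_cvg _ cN sW'; exists a.
have [|B hB] := choice (limits b _); first by move=> k i; have [_ + _] := hb k; apply.
have [|Ph hPh] := choice (limits f _); first by move=> k i; have [_ + _] := hf k; apply.
have B0 : Ph 0%N = B 0%N.
  apply: (@cvg_unique _ (@metric_hausdorff _ X) (x @ W)).
    have [_] := hPh 0%N; rewrite (_ : f^~ 0%N = x) //.
    by apply/funext => k; have [] := hf k.
  have [_] := hB 0%N; rewrite (_ : b^~ 0%N = x) //.
  by apply/funext => k; have [] := hb k.
have BF i : F (B i.+1) (B i).
  apply: (graph_limit (N := N) UW cN (hB i.+1).2 (hB i).2).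
  apply: filterS (ev i.+1) => k ik; have [_ bN bF] := hb k.
  by split; [apply: bN; exact: ltnW|apply: bF; exact: ltnW].
have PF i : F (Ph i) (Ph i.+1).
  apply: (graph_limit (N := N) UW cN (hPh i).2 (hPh i.+1).2).
  apply: filterS (ev i.+1) => k ik; have [_ bN bF] := hf k.
  by split; [apply: bN; do 2 apply: ltnW|apply: bF; exact: ltnW].
have : Defs.Inv F N (B 0%N).
  split; first exact: (hB 0%N).1.
  exists (fun z : int => match z with Posz n => Ph n | Negz n => B n.+1 end).
  split=> // [[n|n]|z]; [exact: (hPh n).1|exact: (hB n.+1).1|].
  case: z => [n|[|n]].
  - by rewrite (_ : Posz n + 1 = Posz n.+1); [exact: PF|lia].
  - by rewrite (_ : Negz 0 + 1 = Posz 0) // B0; exact: BF.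
  - by rewrite (_ : Negz n.+1 + 1 = Negz n); [exact: BF|lia].
move=> /IU UB.
have xB : x @ W --> B 0%N.
  have [_] := hB 0%N; rewrite (_ : b^~ 0%N = x) //.
  by apply/funext => k; have [] := hb k.
have WU : W (x @^-1` U).
  exact: (xB U UB).
have [k Uk] := filter_ex WU.
by have [_ _] := hx' k.
Qed.

(** A weak index pair, as far as the index is concerned: the last condition
    expresses through orbits that the invariant part of [N] lies well inside
    [P.1 \ P.2].  It passes to subsets such as images under [F], which may have
    empty interior. *)
Record npair N P : Prop := NPair {
  np_compact1 : compact P.1;
  np_compact2 : compact P.2;
  np_sub21 : P.2 `<=` P.1;
  np_sub1 : P.1 `<=` N;
  np_invariant1 : mimage F P.1 `&` N `<=` P.1;
  np_invariant2 : mimage F P.2 `&` N `<=` P.2;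
  np_interior : P.1 `\` P.2 `<=` N°;
  np_center : exists k, forall x, backward N k x -> forward N k x -> (P.1 `\` P.2) x }.

Lemma weak_index_npair N P : compact N -> weak_index_pair F N P -> npair N P.
Proof.
move=> cN w; split; try by case: w.
by have [k hk] := orbit_center cN (wip_isolating w); exists k.
Qed.

Definition index_equiv N P K Q : Prop := forall h1 h2 h1' h2',
  gmod_iso (@gen_index _ _ F m Fm P (~` N°) h1 h2)
           (@gen_index _ _ F m Fm Q (~` K°) h1' h2').

Lemma npair_exit1 N P : npair N P -> mimage F P.1 `<=` (addC P (~` N°)).1.
Proof.
move=> w y Fy; have [Ny|nNy] := pselect (N y).
  by left; apply: np_invariant1 w _ (conj Fy Ny).
by right; apply: contra_not nNy; exact: interior_subset.
Qed.

Lemma npair_exit2 N P : npair N P -> mimage F P.2 `<=` (addC P (~` N°)).2.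
Proof.
move=> w y Fy; have [Ny|nNy] := pselect (N y).
  by left; apply: np_invariant2 w _ (conj Fy Ny).
by right; apply: contra_not nNy; exact: interior_subset.
Qed.

Lemma index_equiv_sym N P K Q : index_equiv N P K Q -> index_equiv K Q N P.
Proof. by move=> h h1 h2 h1' h2'; apply: gmod_iso_sym. Qed.

Lemma index_equiv_trans N P K Q N' P' : npair K Q -> index_equiv N P K Q ->
  index_equiv K Q N' P' -> index_equiv N P N' P'.
Proof.
move=> w e1 e2 h1 h2 h1' h2'.
exact: gmod_iso_trans (e1 h1 h2 (npair_exit1 w) (npair_exit2 w)) (e2 _ _ h1' h2').
Qed.

Lemma closed_exit N : closed (~` N°).
Proof. by apply: open_closedC; exact: open_interior. Qed.

Lemma npair_step N P P' : npair N P -> npair N P' -> P'.1 `<=` P.1 -> P'.2 `<=` P.2 ->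
  mimage F P.1 `&` N `<=` P'.1 -> mimage F P.2 `&` N `<=` P'.2 ->
  index_equiv N P N P'.
Proof.
move=> w w' s1 s2 f1 f2 h1 h2 h1' h2'.
have exitP Q : npair N Q -> Q.1 `&` ~` N° `<=` Q.2.
  move=> wQ x [Qx nNx]; apply: contrapT => nQx; apply: nNx.
  by apply: (np_interior wQ).
have image (A B : set X) : mimage F A `&` N `<=` B -> mimage F A `<=` B `|` ~` N°.
  move=> AB y Ay; have [Ny|nNy] := pselect (N y); first by left; apply: AB.
  by right; apply: contra_not nNy; exact: interior_subset.
by apply: (@gen_index_link _ _ _ _ _ _ _ _ _ (~` N°)) => //;
  try (by case: w); try (by case: w'); try exact: closed_exit;
  [exact: exitP|exact: exitP|exact: image|exact: image].
Qed.

Lemma npair_chain N (pr : nat -> set X * set X) : (forall i, npair N (pr i)) ->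
  (forall i, [/\ (pr i.+1).1 `<=` (pr i).1, (pr i.+1).2 `<=` (pr i).2,
     mimage F (pr i).1 `&` N `<=` (pr i.+1).1 &
       mimage F (pr i).2 `&` N `<=` (pr i.+1).2]) ->
  forall n, index_equiv N (pr 0%N) N (pr n).
Proof.
move=> wp step; elim=> [|n IH].
  have w := wp 0%N.
  by apply: npair_step => //; [exact: np_invariant1|exact: np_invariant2].
by apply: (index_equiv_trans (wp n) IH); have [] := step n; exact: npair_step.
Qed.

(** The decreasing sequence from [H] to [G] whose terms beyond [G] consist of
    the ends of longer and longer orbits in [H]. *)
Fixpoint ends N G H n : set X :=
  if n is k.+1 then G `|` (mimage F (ends N G H k) `&` N) else H.

Section Ends.
Variables N G H : set X.
Hypotheses (cN : compact N) (cG : compact G) (cH : compact H) (GH : G `<=` H)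
  (iG : mimage F G `&` N `<=` G) (iH : mimage F H `&` N `<=` H).

Lemma ends_compact n : compact (ends N G H n).
Proof. by elim: n => //= n IH; apply: compactU => //; exact: compact_mimageI. Qed.

Lemma sub_ends n : G `<=` ends N G H n.
Proof. by case: n => //= n; exact: subsetUl. Qed.

Lemma ends_decr n : ends N G H n.+1 `<=` ends N G H n.
Proof.
elim: n => [|n IH] x; first by case=> [/GH|] //; exact: iH.
by case=> [Gx|[[y /IH yn yx] Nx]]; [left|right; split=> //; exists y].
Qed.

Lemma ends_sub n : ends N G H n `<=` H.
Proof. by elim: n => //= n IH; apply: subset_trans (@ends_decr n) IH. Qed.

Lemma ends_step n : mimage F (ends N G H n) `&` N `<=` ends N G H n.+1.
Proof. exact: subsetUr. Qed.

Lemma ends_invariant n : mimage F (ends N G H n) `&` N `<=` ends N G H n.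
Proof. by move=> x /ends_step; exact: ends_decr. Qed.

Lemma ends_backward n x : ends N G H n x -> G x \/ backward H n x.
Proof.
elim: n x => [|n IH] x; first by right.
case=> [|[[y /IH yn yx] Nx]]; first by left.
have Hx : H x.
  apply: iH; split=> //; exists y => //; case: yn; first exact: GH.
  exact: backward_in.
case: yn => [Gy|by_]; first by left; apply: iG; split=> //; exists y.
by right; split=> //; exists y.
Qed.

(** A long orbit in [H] has its middle point in [G], and [G] is kept by [F]
    within [N]. *)
Lemma ends_eventually k : H `<=` N ->
  (forall x, backward H k x -> forward H k x -> G x) ->
  ends N G H (k + k) = G.
Proof.
move=> HN hk; apply/seteqP; split; last exact: sub_ends.
move=> x /ends_backward[//|bx].
suff H0 i y : (i <= k)%N -> backward H (k + i) y -> forward H (k - i) y -> G y.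
  by apply: (H0 k) => //; rewrite subnn; exact: backward_in bx.
elim: i y => [|i IH] y ik; first by rewrite addn0 subn0; exact: hk.
rewrite addnS => -[Hy [z bz zy]] fy.
apply: iG; split; last exact: HN.
exists z => //; apply: IH => //; first exact: ltnW.
by rewrite (_ : (k - i = (k - i.+1).+1)%N);
  [split; [exact: backward_in bz|exists y]|lia].
Qed.

End Ends.

(** First [Q.1] is shrunk to [P.1]: points reached by long orbits in [Q.1] have
    passed through [P.1].  Then the second set is shrunk to [P.2]: no long orbit
    stays in it, since the middle points of long orbits avoid it. *)
Lemma npair_subset N P Q : compact N -> npair N P -> npair N Q ->
  P.1 `<=` Q.1 -> P.2 `<=` Q.2 -> index_equiv N Q N P.
Proof.
move=> cN wP wQ s1 s2; have cX := @metric_hausdorff _ X.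
have [kP hP] := np_center wP; have [kQ hQ] := np_center wQ.
have [cP1 cP2 P21 PN iP1 iP2 intP _] := wP.
have [cQ1 cQ2 Q21 QN iQ1 iQ2 intQ _] := wQ.
have clQ2 : closed Q.2 by exact: compact_closed.
pose A := ends N P.1 Q.1; pose pA i : set X * set X := (A i, A i `&` Q.2).
have wA i : npair N (pA i).
  split=> /=.
  - exact: ends_compact.
  - by apply: compact_closedI => //; exact: ends_compact.
  - by move=> x [].
  - by move=> x /(ends_sub s1 iQ1) /QN.
  - exact: ends_invariant.
  - move=> x [[y [Ay Qy] yx] Nx]; split.
      by apply: (ends_invariant s1 iQ1 (n := i)); split=> //; exists y.
    by apply: iQ2; split=> //; exists y.
  - move=> x [Ax nQx]; apply: intQ; split; first exact: ends_sub Ax.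
    by move=> Qx; apply: nQx.
  - exists (maxn kP kQ) => x bx fx; split.
      by apply: sub_ends; have [] :=
        hP x (backward_le (leq_maxl _ _) bx) (forward_le (leq_maxl _ _) fx).
    by move=> [_]; have [] := hQ x (backward_le (leq_maxr _ _) bx) (forward_le (leq_maxr _ _) fx).
have eA : index_equiv N Q N (P.1, P.1 `&` Q.2).
  have e0 : pA 0%N = Q.
    rewrite /pA /A /= [RHS](_ : _ = (Q.1, Q.2)); last by case: (Q).
    by congr (_, _); apply/seteqP; split=> [x []//|x Qx]; split=> //; exact: Q21.
  have en : pA (kP + kP)%N = (P.1, P.1 `&` Q.2).
    rewrite /pA /A ends_eventually // => x bx fx.
    by have [] := hP x (backward_sub QN bx) (forward_sub QN fx).
  rewrite -en -[Q in index_equiv _ Q]e0.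
  apply: npair_chain => // i; split=> /=.
  - exact: ends_decr.
  - by move=> x [/(ends_decr s1 iQ1) ?].
  - exact: ends_step.
  - move=> x [[y [Ay Qy] yx] Nx]; split; first by right; split=> //; exists y.
    by apply: iQ2; split=> //; exists y.
have wI : npair N (P.1, P.1 `&` Q.2).
  have := wA (kP + kP)%N; rewrite /pA /A ends_eventually // => x bx fx.
  by have [] := hP x (backward_sub QN bx) (forward_sub QN fx).
apply: (index_equiv_trans wI eA).
have [_ cI2 I21 _ _ iI2 intI [kI hI]] := wI; rewrite /= in cI2 I21 iI2 intI hI.
pose I2 := P.1 `&` Q.2; have PI2 : P.2 `<=` I2 by move=> x Px; split;
  [exact: P21|exact: s2].
pose B := ends N P.2 I2.
have hB x : backward I2 kI x -> forward I2 kI x -> P.2 x.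
  have I2N : I2 `<=` N by move=> y [/PN].
  move=> bx fx; have [_ nI] := hI x (backward_sub I2N bx) (forward_sub I2N fx).
  by have := nI (backward_in bx).
have wB i : npair N (P.1, B i).
  split=> //=.
  - exact: ends_compact.
  - by move=> x /(ends_sub PI2 iI2) [].
  - exact: ends_invariant.
  - move=> x [Px nBx]; apply: intP; split=> // P2x; apply: nBx.
    exact: sub_ends.
  - exists kI => x bx fx; have [Px nI] := hI x bx fx; split=> //.
    by move=> /(ends_sub PI2 iI2).
have -> : P = (P.1, B (kI + kI)%N).
  rewrite /B ends_eventually //; first by case: (P).
  by move=> x [/PN].
apply: (npair_chain (pr := fun i => (P.1, B i))) => // i; split=> //=.
- exact: ends_decr.
- exact: ends_step.
Qed.

Lemma npair_equiv N P Q : compact N -> npair N P -> npair N Q -> index_equiv N P N Q.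
Proof.
move=> cN wP wQ; have cX := @metric_hausdorff _ X.
have [kP hP] := np_center wP; have [kQ hQ] := np_center wQ.
have [cP1 cP2 P21 PN iP1 iP2 intP _] := wP.
have [cQ1 cQ2 Q21 QN iQ1 iQ2 intQ _] := wQ.
have wI : npair N (P.1 `&` Q.1, P.2 `&` Q.2).
  split=> /=.
  - by apply: compact_closedI => //; exact: compact_closed.
  - by apply: compact_closedI => //; exact: compact_closed.
  - by move=> x [/P21 ? /Q21].
  - by move=> x [/PN].
  - by move=> x [[y [Py Qy] yx] Nx]; split; [apply: iP1|apply: iQ1]; split=> //;
      exists y.
  - by move=> x [[y [Py Qy] yx] Nx]; split; [apply: iP2|apply: iQ2]; split=> //;
      exists y.
  - move=> x [[Px Qx] nx]; have [P2x|nP2x] := pselect (P.2 x); last by apply: intP.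
    by apply: intQ; split=> // Q2x; apply: nx.
  - exists (maxn kP kQ) => x bx fx.
    have [Px nPx] := hP x (backward_le (leq_maxl _ _) bx) (forward_le (leq_maxl _ _) fx).
    have [Qx nQx] := hQ x (backward_le (leq_maxr _ _) bx) (forward_le (leq_maxr _ _) fx).
    by split=> // -[].
apply: (index_equiv_trans wI).
  by apply: npair_subset => // x [].
by apply/index_equiv_sym; apply: npair_subset => // x [].
Qed.

(** Passing to a smaller isolating neighbourhood [K]: the points of [P.1] with
    a long backward orbit either lie in [K] or leave [N] after boundedly many
    steps, so adding the forward orbits of the latter to [P.2] gives a pair
    whose difference lies in the interior of [K]. *)
Lemma npair_restrict N K P : compact N -> compact K -> K `<=` N ->
  Defs.Inv F N `<=` K° ->
  npair N P -> exists2 Q, npair K Q & index_equiv N P K Q.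
Proof.
move=> cN cK KN IK wP; have cX := @metric_hausdorff _ X.
have [k0 hk0] : exists k, forall x, backward N k x -> forward N k x -> K° x.
  by apply: orbit_center => // x /IK; exact: nbhs_interior.
have [kP hP] := np_center wP.
have [cP1 cP2 P21 PN iP1 iP2 intP _] := wP.
have s0 : set0 `<=` P.1 by [].
have i0 : mimage F set0 `&` N `<=` (set0 : set X) by move=> x [[y []]].
pose A := ends N set0 P.1 k0.
have cA : compact A by apply: ends_compact => //; exact: compact0.
have AP : A `<=` P.1 by exact: ends_sub.
have iA : mimage F A `&` N `<=` A by exact: ends_invariant.
have bA x : A x -> backward N k0 x by move=> /(ends_backward s0 i0 iP1) [//|]; exact:
  backward_sub.
(* Points of [A] outside the interior of [K], followed for [j] steps inside [N];
   [E k0] is empty as its points would be ends of orbits with middle points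
   outside [K]. *)
pose E := fix E j := if j is i.+1 then mimage F (E i) `&` N else A `&` ~` K°.
have cE j : compact (E j).
  elim: j => [|j IH]; last exact: compact_mimageI.
  by apply: compact_closedI => //; exact: closed_exit.
have EA j : E j `<=` A.
  elim: j => [|j IH]; first by move=> x [].
  by move=> x [[y /IH Ay yx] Nx]; apply: iA; split=> //; exists y.
have E0 j x : (j <= k0)%N -> E j x -> ~ forward N (k0 - j) x.
  elim: j x => [|j IH] x jk.
    by move=> [/bA bx nK]; rewrite subn0 => fx; apply/nK/hk0.
  move=> [[y Ey yx] Nx] fx; apply: (IH y (ltnW jk) Ey).
  rewrite (_ : (k0 - j = (k0 - j.+1).+1)%N); last by lia.
  by split; [apply/PN/AP/EA; exact: Ey|exists x].
have Ek0 x : ~ E k0 x.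
  by move=> Ex; apply: (E0 k0 x (leqnn _) Ex); rewrite subnn; apply/PN/AP/EA; exact: Ex.
pose B := (P.2 `&` A) `|` \bigcup_(j < k0) E j.
have BA : B `<=` A by move=> x [[]//|[j _ /EA]].
have AK : A `\` B `<=` K°.
  move=> x [Ax nBx]; apply: contrapT => nK; apply: nBx; right.
  have E0x : E 0%N x by [].
  by exists 0%N => //=; case: (k0) (Ek0 x) => // /(_ E0x).
have wB : npair N (A, B).
  split=> //=.
  - apply: compactU; first by apply: compact_closedI => //; exact: compact_closed.
    by rewrite bigcup_mkord; apply: bigsetU_compact.
  - by move=> x /AP /PN.
  - move=> x [[y [[Py Ay]|[j /= jk Ey]] yx] Nx].
      by left; split; [apply: iP2|apply: iA]; split=> //; exists y.
    have Ex : E j.+1 x by split=> //; exists y.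
    right; exists j.+1 => //=.
    by move: jk; rewrite leq_eqVlt => /predU1P[jk|//]; rewrite jk in Ex; have :=
      Ek0 x Ex.
  - by apply: subset_trans AK _; exact: interiorS.
  - exists (kP + k0)%N => x bx fx.
    have [Px nPx] := hP x (backward_le (leq_addr _ _) bx) (forward_le (leq_addr _ _) fx).
    split.
      have Ai i y : backward N (kP + i) y -> forward N kP y -> ends N set0 P.1 i y.
        elim: i y => [|i IH] y; first by rewrite addn0 => b_ f_; have [] := hP y b_ f_.
        rewrite addnS => -[Ny [z bz zy]] fy; right; split=> //; exists z => //.
        apply: IH => //; apply: (@forward_le _ kP.+1) => //=.
        by split; [exact: backward_in bz|exists y].
      by apply: Ai => //; exact: forward_le (leq_addr _ _) fx.
    move=> [[]//|[j /= jk Ejx]]; apply: (E0 j x (ltnW jk) Ejx).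
    by apply: forward_le fx; lia.
have wQ : npair K (A `&` K, B `&` K).
  have clK : closed K by exact: compact_closed.
  split=> /=.
  - exact: compact_closedI.
  - by apply: compact_closedI => //; case: wB.
  - by move=> x [/BA].
  - by move=> x [].
  - by move=> x [[y [Ay _] yx] Kx]; split=> //; apply: iA; split; [exists y|exact: KN].
  - move=> x [[y [By _] yx] Kx]; split=> //.
    by apply: (np_invariant2 wB); split; [exists y|exact: KN].
  - by move=> x [[Ax Kx] nB]; apply: AK; split=> // Bx; apply: nB.
  - have [k hk] := np_center wB; exists k => x bx fx.
    have [Ax nBx] := hk x (backward_sub KN bx) (forward_sub KN fx).
    by split; [split=> //; exact: backward_in bx|move=> []].
exists (A `&` K, B `&` K) => //.
apply: (index_equiv_trans wB (npair_equiv cN wP wB)) => h1 h2 h1' h2'.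
have [_ cB BA' _ _ iB _ _] := wB; have [cAK cBK BAK _ _ _ _ _] := wQ.
apply: (@gen_index_link _ _ _ _ _ _ _ _ _ (~` K°)) => //=; try exact: closed_exit.
- by apply: subsetC; exact: interiorS.
- by move=> x [Ax nK]; apply: contrapT => nB; apply/nK/AK.
- by move=> x [[Ax Kx] nK]; split=> //; apply: contrapT => nB; apply/nK/AK.
- move=> y Fy; have [Ky|nKy] := pselect (K° y); last by right.
  have Ky' := interior_subset Ky; left; split=> //.
  by apply: iA; split=> //; exact: KN.
- move=> y Fy; have [Ky|nKy] := pselect (K° y); last by right.
  have Ky' := interior_subset Ky; left; split=> //.
  by apply: iB; split=> //; exact: KN.
Qed.

End Dynamics.

Theorem theorem6p4 (R : realType) (X : metricType R) (F : X -> int -> set X)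
  (m : gmorphism X) (S N M : set X) (P Q : set X * set X)
  (hX : locally_compact [set: X])
  (hF : is_dmds F)
  (hm : determined_by (generator F) m)
  (hS : isolated_invariant (generator F) S)
  (hN : isolating_neighbourhood_for (generator F) S N)
  (hM : isolating_neighbourhood_for (generator F) S M)
  (hP : weak_index_pair (generator F) N P)
  (hQ : weak_index_pair (generator F) M Q) :
  gmod_iso (conley_index hm hP) (conley_index hm hQ).
Proof.
have [[cN IN] SN] := hN; have [[cM IM] SM] := hM.
have wP := weak_index_npair hm cN hP; have wQ := weak_index_npair hm cM hQ.
have cK : compact (N `&` M).
  by apply: compact_closedI => //; apply: compact_closed => //; exact: metric_hausdorff.
have SK : S `<=` (N `&` M)°.
  by rewrite interiorI => x Sx; split; [apply: IN; rewrite -SN|apply: IM; rewrite -SM].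
have [P' wP' eP] : exists2 P', npair (generator F) (N `&` M) P' &
    index_equiv hm N P (N `&` M) P'.
  by apply: npair_restrict => //; rewrite -SN.
have [Q' wQ' eQ] : exists2 Q', npair (generator F) (N `&` M) Q' &
    index_equiv hm M Q (N `&` M) Q'.
  by apply: npair_restrict => //; rewrite -SM.
have e : index_equiv hm N P M Q.
  apply: (index_equiv_trans wP' eP).
  apply: (index_equiv_trans wQ' (npair_equiv hm cK wP' wQ')).
  exact: index_equiv_sym.
exact: e (mimage_Tpair1 hP) (mimage_Tpair2 hP) (mimage_Tpair1 hQ) (mimage_Tpair2 hQ).
Qed.
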